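(* Let $\Sigma,\Gamma$ be finite alphabets. Every MSO-definable partial function $f$ from unordered forests over $\Sigma$ to unordered forests over $\Gamma$ is expressed by some bottom-up register automaton with values in the two-sorted algebra $\mathbf{UCF}$ of unordered forests and one-hole contexts over $\Gamma$. That is, there is such an automaton $M$, reading binary trees, such that for every unordered forest $h$ over $\Sigma$ and every binary tree $t$ that is a first-child-next-sibling encoding of $h$, $[\![M]\!](t)=\{f(h)\}$ if $f(h)$ is defined, and $[\![M]\!](t)=\emptyset$ otherwise.
   Context: Unordered forests. An unordered tree is an unranked labelled finite tree in which the children of each node form a multiset (no order). An unordered forest is a finite multiset of unordered trees; $\emptyset$ is the empty forest, $+$ is multiset union, and $\mathrm{root}_a(t_1+\dots+t_n)$ is the tree with root labelled $a$ and children $t_1,\dots,t_n$. Encoding. Binary trees are terms over the ranked signature consisting of each $a\in\Sigma$ with rank $2$ and a symbol $\bot$ of rank $0$. The decoding is $\mathrm{dec}(\bot)=\emptyset$, $\mathrm{dec}(a(t_1,t_2))=\mathrm{root}_a(\mathrm{dec}(t_1))+\mathrm{dec}(t_2)$. A binary tree $t$ is a first-child-next-sibling encoding of $h$ if $\mathrm{dec}(t)=h$. MSO-definable functions. An unordered forest is viewed as a relational structure on its set of nodes with the relation $\mathrm{Child}(x,y)$ ($y$ is a child of $x$) and unary label predicates. An MSO-definable function with $n$ copies creates for every input node $x$ up to $n$ output nodes $x_1,\dots,x_n$; it is given by monadic second-order formulas over the input structure: a closed formula defining the domain, formulas with one free variable specifying for each $i$ whether $x_i$ is present and what its label is, and formulas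 $\varphi_{\mathrm{Child},i,j}(x,y)$ for $1\le i,j\le n$ specifying whether $y_j$ is a child of $x_i$ in the output. The output structure must be an unordered forest for every input in the domain. $\mathbf{UCF}$. Let $\circ$ be a hole symbol that may be used as a leaf, in place of a tree. $\mathbf{UCF}$ is the two-sorted algebra whose elements of type $0$ are unordered forests (no $\circ$) and whose elements of type $1$ are unordered forests with exactly one occurrence of $\circ$. Its operations are $+$ (on pairs of types $(0,0),(0,1),(1,0)$), $\mathrm{root}_a$ for each letter $a$ (on each type), and substitution $h[\circ:=g]$, replacing the hole (if any) of $h$ by $g$ (on every pair of types). An operation defined on several combinations of types is regarded as one typed operation for each combination. Polynomial functions. For an algebra with universe $A$, a polynomial function $A^k\to A$ is a function induced by a term built from variables, elements of $A$ as constants, and the operations of the algebra; a polynomial function $A^k\to A^m$ is an $m$-tuple of such functions. In a multi-sorted algebra, terms and polynomial functions are required to be well typed. Register automata. A bottom-up register automaton with values in an algebra with universe $A$ is a tuple $M=(\Delta,n,Q,\delta,F)$ where $\Delta$ is a ranked signature, $n$ is the number of registers, $Q$ is a finite set of states, $\delta$ is a finite set of rules $a(q_1,\dots,q_k)\to q,f$ with $a\in\Delta$ of rank $k$, $q,q_1,\dots,q_k\in Q$, and $f:A^{n\times k}\to A^n$ a polynomial function, and $F$ is a partial function associating to some states $q$ a polynomial function $f_q:A^n\to A$. In the multi-sorted case each state has a fixed tuple of types for its registers, and all functions are typed accordingly. Inductively, $a(t_1,\dots,t_k)\to(q,f(\bar r_1,\dots,\bar r_k))$ whenever $a(q_1,\dots,q_k)\to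 q,f$ is in $\delta$ and $t_i\to(q_i,\bar r_i)$ for all $i$; and $[\![M]\!](t)$ is the set of all $f_q(\bar r)$ such that $t\to(q,\bar r)$ and $F(q)=f_q$ is defined. *)

(* Defs.v *)
From HB Require Import structures.
From mathcomp Require Import all_boot generic_quotient.
From mathcomp Require Import boolp classical_sets.

Set Implicit Arguments.
Unset Strict Implicit.
Unset Printing Implicit Defensive.

Local Open Scope quotient_scope.

(* Ordered trees whose leaves may be the hole symbol; the quotient by
   reordering of siblings is taken below. *)
Inductive tree (A : Type) : Type :=
| Hole
| Node (a : A) (s : seq (tree A)).

Arguments Hole {A}.

Section TreeChoice.
Variable A : Type.

Lemma tree_nested_ind (P : tree A -> Prop) (Q : seq (tree A) -> Prop) :
  P Hole -> (forall a s, Q s -> P (Node a s)) ->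
  Q [::] -> (forall t s, P t -> Q s -> Q (t :: s)) -> forall t, P t.
Proof.
move=> PH PN Q0 QS; fix IH 1 => -[|a s]; first exact: PH.
by apply: PN; elim: s => [|t s IHs]; [exact: Q0 | apply: QS].
Qed.

Fixpoint tree_encode (t : tree A) : GenTree.tree A :=
  if t is Node a s then GenTree.Node 1 (GenTree.Leaf a :: map tree_encode s)
  else GenTree.Node 0 [::].

Fixpoint tree_decode (t : GenTree.tree A) : tree A :=
  if t is GenTree.Node _ (GenTree.Leaf a :: s) then Node a (map tree_decode s)
  else Hole.

Lemma tree_encodeK : cancel tree_encode tree_decode.
Proof.
apply: (@tree_nested_ind _ (fun s => map tree_decode (map tree_encode s) = s)).
- by [].
- by move=> a s /= ->.
- by [].
- by move=> t s /= -> ->.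
Qed.
End TreeChoice.

HB.instance Definition _ (A : choiceType) :=
  Choice.copy (tree A) (can_type (@tree_encodeK A)).

Inductive feq (A : Type) : seq (tree A) -> seq (tree A) -> Prop :=
| feq_refl s : feq s s
| feq_trans s t u : feq s t -> feq t u -> feq s u
| feq_swap x y s : feq (x :: y :: s) (y :: x :: s)
| feq_skip x s t : feq s t -> feq (x :: s) (x :: t)
| feq_node a c d s : feq c d -> feq (Node a c :: s) (Node a d :: s).

Lemma feq_sym (A : Type) (s t : seq (tree A)) : feq s t -> feq t s.
Proof.
elim=> {s t} [s|s t u _ ts _ ut|x y s|x s t _ ts|a c d s _ dc].
- exact: feq_refl.
- exact: feq_trans ut ts.
- exact: feq_swap.
- exact: feq_skip.
- exact: feq_node.
Qed.

Section Hforest.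
Variable A : choiceType.

Definition feqb : rel (seq (tree A)) := fun s t => `[< feq s t >].

Lemma feqb_refl : reflexive feqb.
Proof. by move=> s; apply/asboolP; exact: feq_refl. Qed.
Lemma feqb_sym : symmetric feqb.
Proof. by move=> s t; apply: asbool_equiv_eq; split; exact: feq_sym. Qed.
Lemma feqb_trans : transitive feqb.
Proof.
by move=> t s u /asboolP st /asboolP tu; apply/asboolP; exact: feq_trans st tu.
Qed.

Canonical feq_equiv := EquivRel feqb feqb_refl feqb_sym feqb_trans.

(* Unordered forests with any number of holes. *)
Definition hforest := {eq_quot feq_equiv}.

Lemma hforestP (s t : seq (tree A)) :
  \pi_hforest s = \pi_hforest t <-> feq s t.
Proof.
split=> [/eqP|st]; first by rewrite eqquotE => /asboolP.
by apply/eqP; rewrite eqquotE; apply/asboolP.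
Qed.

Lemma feq_repr (s : seq (tree A)) : feq (repr (\pi_hforest s)) s.
Proof. by apply/hforestP; rewrite reprK. Qed.

End Hforest.

Fixpoint tholes (A : Type) (t : tree A) : nat :=
  if t is Node _ s then sumn (map (@tholes A) s) else 1.
Definition nholes (A : Type) (s : seq (tree A)) : nat := sumn (map (@tholes A) s).

Fixpoint tsubst (A : Type) (g : seq (tree A)) (t : tree A) : seq (tree A) :=
  if t is Node a s then [:: Node a (flatten (map (tsubst g) s))] else g.
Definition fsubst (A : Type) (s g : seq (tree A)) : seq (tree A) :=
  flatten (map (tsubst g) s).

Section Compat.
Variable A : Type.
Implicit Types s t u g : seq (tree A).

Lemma nholes_cat s t : nholes (s ++ t) = nholes s + nholes t.
Proof. by rewrite /nholes map_cat sumn_cat. Qed.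

Lemma nholes_subst s g : nholes (fsubst s g) = nholes s * nholes g.
Proof.
have cons_case (t : tree A) u : nholes (tsubst g t) = tholes t * nholes g ->
    nholes (fsubst u g) = nholes u * nholes g ->
    nholes (fsubst (t :: u) g) = nholes (t :: u) * nholes g.
  by move=> tP uP; rewrite [LHS]nholes_cat tP -/(fsubst u g) uP -mulnDl.
elim: s => // t s; apply: (cons_case).
apply: (@tree_nested_ind A (fun t : tree A => nholes (tsubst g t) = tholes t * nholes g)
  (fun s => nholes (fsubst s g) = nholes s * nholes g)) => //.
- by rewrite mul1n.
- by move=> a u uP; rewrite [LHS]addn0.
Qed.

Lemma feq_nholes s t : feq s t -> nholes s = nholes t.
Proof.
elim=> {s t} [//|s t u _ -> _ ->//|x y s|x s t _ st|a c d s _ cd].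
- exact: addnCA.
- by congr (_ + _).
- by congr (_ + _).
Qed.

Lemma feq_catl u s t : feq s t -> feq (u ++ s) (u ++ t).
Proof. by move=> st; elim: u => //= x u; exact: feq_skip. Qed.

Lemma feq_catr u s t : feq s t -> feq (s ++ u) (t ++ u).
Proof.
elim=> {s t} [s|s t v _ st _ tv|x y s|x s t _ st|a c d s cd _] /=.
- exact: feq_refl.
- exact: feq_trans st tv.
- exact: feq_swap.
- exact: feq_skip.
- exact: feq_node.
Qed.

Lemma feq_cat s s' t t' : feq s s' -> feq t t' -> feq (s ++ t) (s' ++ t').
Proof.
by move=> ss' tt'; apply: feq_trans (feq_catr _ ss') (feq_catl _ tt').
Qed.

Lemma feq_catC s t : feq (s ++ t) (t ++ s).
Proof.
elim: s => [|x s IHs] /=; first by rewrite cats0; exact: feq_refl.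
apply: feq_trans (feq_skip x IHs) _.
elim: t {IHs} => [|y t IHt] /=; first exact: feq_refl.
exact: feq_trans (feq_swap _ _ _) (feq_skip _ IHt).
Qed.

Lemma feq_substl g s t : feq s t -> feq (fsubst s g) (fsubst t g).
Proof.
elim=> {s t} [s|s t v _ st _ tv|x y s|x s t _ st|a c d s _ cd].
- exact: feq_refl.
- exact: feq_trans st tv.
- by rewrite /fsubst /= !catA; apply: feq_catr; apply: feq_catC.
- exact: feq_catl.
- exact: feq_node.
Qed.

Lemma feq_substr s g h : feq g h -> feq (fsubst s g) (fsubst s h).
Proof.
move=> gh; elim: s => [|x s IHs]; first exact: feq_refl.
apply: feq_cat IHs.
apply: (@tree_nested_ind A (fun t : tree A => feq (tsubst g t) (tsubst h t))
  (fun s => feq (fsubst s g) (fsubst s h))) => //.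
- by move=> a u uP; apply: feq_node.
- exact: feq_refl.
- by move=> y u yP uP; apply: feq_cat.
Qed.

End Compat.

Section UCF.
Variable A : choiceType.

(* Unordered forests with exactly [k] holes. *)
Definition ucf (k : nat) : Type := {h : hforest A | nholes (repr h) == k}.

Lemma ucf_pi_subproof (k : nat) (s : seq (tree A)) :
  nholes s = k -> nholes (repr (\pi_(hforest A) s)) == k.
Proof. by move=> <-; apply/eqP/feq_nholes/feq_repr. Qed.

Definition ucf_pi (k : nat) (s : seq (tree A)) (sk : nholes s = k) : ucf k :=
  exist _ (\pi_(hforest A) s) (ucf_pi_subproof sk).

Definition forest_of (k : nat) (h : ucf k) : seq (tree A) := repr (val h).

Lemma forest_ofP (k : nat) (h : ucf k) : nholes (forest_of h) = k.
Proof. exact/eqP/(valP h). Qed.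

(* The operations below act on representatives; they descend to the quotient by
   [feq_cat], [feq_node], [feq_substl] and [feq_substr]. *)
Lemma uempty_subproof : nholes (Nil (tree A)) = 0. Proof. by []. Qed.
Definition uempty : ucf 0 := ucf_pi uempty_subproof.

Lemma uadd_subproof i j (g : ucf i) (h : ucf j) :
  nholes (forest_of g ++ forest_of h) = i + j.
Proof. by rewrite nholes_cat !forest_ofP. Qed.
Definition uadd i j (g : ucf i) (h : ucf j) : ucf (i + j) :=
  ucf_pi (uadd_subproof g h).

Lemma uroot_subproof (a : A) i (h : ucf i) : nholes [:: Node a (forest_of h)] = i.
Proof. by rewrite [LHS]addn0 [LHS]forest_ofP. Qed.
Definition uroot (a : A) i (h : ucf i) : ucf i := ucf_pi (uroot_subproof a h).

(* Types 0 and 1 are encoded by [false] and [true]. *)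
Lemma usubst_subproof (i j : bool) (h : ucf i) (g : ucf j) :
  nholes (fsubst (forest_of h) (forest_of g)) = i && j.
Proof. by rewrite nholes_subst !forest_ofP mulnb. Qed.
Definition usubst (i j : bool) (h : ucf i) (g : ucf j) : ucf (i && j) :=
  ucf_pi (usubst_subproof h g).

End UCF.

Arguments uempty {A}.

Definition uforest (A : choiceType) : Type := ucf A 0.

(* Many-sorted algebras; [apply_op o x] applies [o] to the family of its
   arguments. *)
Record algebra := Algebra {
  sort : Type;
  carrier :> sort -> Type;
  op : Type;
  arity : op -> nat;
  argsort : forall o, 'I_(arity o) -> sort;
  ressort : op -> sort;
  apply_op : forall o, (forall i, carrier (@argsort o i)) -> carrier (ressort o)
}.

Arguments argsort {a o}.
Arguments apply_op {a o}.

Inductive ucf_op (A : Type) : Type :=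
| Add00 | Add01 | Add10
| Root (a : A) (i : bool)
| Subst (i j : bool).

Definition ucf_arity (A : Type) (o : ucf_op A) : nat :=
  if o is Root _ _ then 1 else 2.

Definition ucf_argsort (A : Type) (o : ucf_op A) :
    'I_(ucf_arity o) -> bool :=
  match o return 'I_(ucf_arity o) -> bool with
  | Add00 => fun=> false
  | Add01 => fun k => k != ord0
  | Add10 => fun k => k == ord0
  | Root _ i => fun=> i
  | Subst i j => fun k => if k == ord0 then i else j
  end.

Definition ucf_ressort (A : Type) (o : ucf_op A) : bool :=
  match o with
  | Add00 => false
  | Add01 | Add10 => true
  | Root _ i => i
  | Subst i j => i && j
  end.

Definition ucf_apply (A : choiceType) (o : ucf_op A) :
    (forall k, ucf A (ucf_argsort (o := o) k)) -> ucf A (ucf_ressort o) :=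
  match o return (forall k, ucf A (ucf_argsort (o := o) k)) ->
                 ucf A (ucf_ressort o) with
  | Add00 => fun x => uadd (x ord0) (x ord_max)
  | Add01 => fun x => uadd (x ord0) (x ord_max)
  | Add10 => fun x => uadd (x ord0) (x ord_max)
  | Root a i => fun x => uroot a (x ord0)
  | Subst i j => fun x => usubst (x ord0) (x ord_max)
  end.

Definition UCF (A : choiceType) : algebra :=
  @Algebra bool (fun i => ucf A i) (ucf_op A) (@ucf_arity A) (@ucf_argsort A)
    (@ucf_ressort A) (@ucf_apply A).

(* A polynomial function is given by the terms inducing it. *)
Inductive term (R : algebra) (V : Type) (vs : V -> sort R) : sort R -> Type :=
| Var v : term vs (vs v)
| Const s (c : R s) : term vs s
| App (o : op R) (x : forall i : 'I_(arity o), term vs (argsort i)) :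
    term vs (ressort o).

Fixpoint eval (R : algebra) (V : Type) (vs : V -> sort R)
    (r : forall v, R (vs v)) (s : sort R) (e : term vs s) : R s :=
  match e in term _ s return R s with
  | Var v => r v
  | Const _ c => c
  | App _ x => apply_op (fun i => eval r (x i))
  end.

Record ranked_sig := RankedSig { symbol :> finType; rank : symbol -> nat }.

Inductive rtree (D : ranked_sig) : Type :=
| RNode (a : D) (c : 'I_(rank a) -> rtree D).

(* A rule a(q_1, ..., q_k) -> q, f. The variable [(i, r)] of [f] is the [r]-th
   register of the [i]-th child. *)
Record rule (R : algebra) (n : nat) (Q : Type) (regsort : Q -> 'I_n -> sort R)
    (k : nat) := Rule {
  source : 'I_k -> Q;
  target : Q;
  update : forall r : 'I_n,
    term (fun v : 'I_k * 'I_n => regsort (source v.1) v.2) (regsort target r)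
}.

(* The finite set of rules is given, for each of the finitely many symbols, as a
   finite family. *)
Record reg_automaton (D : ranked_sig) (R : algebra) := RegAutomaton {
  nreg : nat;
  state : finType;
  regsort : state -> 'I_nreg -> sort R;
  rule_idx : D -> finType;
  rules : forall a : D, rule_idx a -> rule regsort (rank a);
  final : forall q : state, option {s : sort R & term (regsort q) s}
}.

Section Semantics.
Variables (D : ranked_sig) (R : algebra) (M : reg_automaton D R).

Inductive run : rtree D ->
    forall q : state M, (forall r, R (@regsort D R M q r)) -> Prop :=
| Run (a : D) (rho : rule_idx M a) (c : 'I_(rank a) -> rtree D)
    (x : forall i r, R (regsort (source (rules rho) i) r)) :
    (forall i, run (c i) (x i)) ->
    run (RNode c)
      (fun r => eval (fun v => x v.1 v.2) (update (rules rho) r)).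

Definition outputs (t : rtree D) : set {s : sort R & R s} :=
  [set y | exists (q : state M) (x : forall r, R (regsort q r))
     (f : {s : sort R & term (regsort q) s}),
     [/\ run t x, final q = Some f & y = Tagged _ (eval x (tagged f))]].

End Semantics.

Definition bin_sig (A : finType) : ranked_sig :=
  @RankedSig (option A) (fun a => if a is Some _ then 2 else 0).

Definition dec_symbol (A : finType) (a : bin_sig A) :
    ('I_(rank a) -> uforest A) -> uforest A :=
  match a return ('I_(rank (a : bin_sig A)) -> uforest A) -> uforest A with
  | None => fun=> uempty
  | Some a => fun x => uadd (uroot a (x ord0)) (x ord_max)
  end.

Fixpoint dec (A : finType) (t : rtree (bin_sig A)) : uforest A :=
  let: RNode _ c := t in dec_symbol (fun i => dec (c i)).

Record structure (A : Type) := Structure {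
  node :> finType;
  child : rel node;
  label : A -> pred node
}.

Definition iso (A : Type) (S T : structure A) : Prop :=
  exists phi : S -> T, [/\ bijective phi,
    forall x y, child (phi x) (phi y) = child x y &
    forall a x, label a (phi x) = label a x].

Definition sempty (A : Type) : structure A :=
  @Structure A void (fun _ _ => false) (fun _ _ => false).

Definition sunion (A : Type) (S T : structure A) : structure A :=
  @Structure A (S + T)%type
    (fun x y => match x, y with
      | inl x, inl y => child x y
      | inr x, inr y => child x y
      | _, _ => false
      end)
    (fun a x => match x with inl x => label a x | inr x => label a x end).

(* [None] is the new root; its children are the nodes that had no parent. *)
Definition sroot (A : eqType) (b : A) (S : structure A) : structure A :=
  @Structure A (option S)
    (fun x y => match x, y with
      | Some x, Some y => child x y
      | None, Some y => [forall z, ~~ child z y]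
      | _, None => false
      end)
    (fun a x => if x is Some x then label a x else a == b).

(* Holes are not nodes; only forests without holes are used as structures. *)
Fixpoint tstruct (A : eqType) (t : tree A) : structure A :=
  if t is Node a s then
    sroot a (foldr (fun t S => sunion (tstruct t) S) (sempty A) s)
  else sempty A.

Definition fstruct (A : eqType) (s : seq (tree A)) : structure A :=
  foldr (fun t S => sunion (tstruct t) S) (sempty A) s.

(* A representative is used, but the structure does not depend on it up to
   isomorphism: see [feq_iso]. *)
Definition ustruct (A : choiceType) (h : uforest A) : structure A :=
  fstruct (forest_of h).

Section Iso.
Variable A : eqType.
Implicit Types S T U : structure A.

Lemma iso_refl S : iso S S.
Proof. by exists id; split=> //; exists id. Qed.

Lemma iso_trans S T U : iso S T -> iso T U -> iso S U.
Proof.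
move=> [f [fb fc fl]] [g [gb gc gl]]; exists (g \o f); split.
- exact: bij_comp.
- by move=> x y; rewrite /= gc fc.
- by move=> a x; rewrite /= gl fl.
Qed.

Lemma iso_union S S' T T' :
  iso S S' -> iso T T' -> iso (sunion S T) (sunion S' T').
Proof.
move=> [f [[f' fK f'K] fc fl]] [g [[g' gK g'K] gc gl]].
exists (fun x => match x with inl x => inl (f x) | inr x => inr (g x) end).
split.
- exists (fun x => match x with inl x => inl (f' x) | inr x => inr (g' x) end).
  + by case=> x; rewrite ?fK ?gK.
  + by case=> x; rewrite ?f'K ?g'K.
- by case=> x [] y /=; rewrite ?fc ?gc.
- by move=> a [] x /=; rewrite ?fl ?gl.
Qed.

Lemma iso_unionCA S T U : iso (sunion S (sunion T U)) (sunion T (sunion S U)).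
Proof.
exists (fun x => match x with
  | inl x => inr (inl x) | inr (inl x) => inl x | inr (inr x) => inr (inr x)
  end); split.
- exists (fun x => match x with
    | inl x => inr (inl x) | inr (inl x) => inl x | inr (inr x) => inr (inr x)
    end); by case=> [x|[x|x]].
- by case=> [x|[x|x]] [y|[y|y]].
- by move=> a [x|[x|x]].
Qed.

Lemma iso_root b S T : iso S T -> iso (sroot b S) (sroot b T).
Proof.
move=> [f [[f' fK f'K] fc fl]]; exists (omap f); split.
- by exists (omap f'); case=> //= x; rewrite ?fK ?f'K.
- case=> [x|] [y|] //=; apply/forallP/forallP => yP z.
    by rewrite -fc.
  by rewrite -[z]f'K fc.
- by move=> a [x|] /=.
Qed.

Lemma feq_iso (s t : seq (tree A)) : feq s t -> iso (fstruct s) (fstruct t).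
Proof.
elim=> {s t} [s|s t u _ st _ tu|x y s|x s t _ st|a c d s _ cd].
- exact: iso_refl.
- exact: iso_trans st tu.
- exact: iso_unionCA.
- by apply: iso_union st; exact: iso_refl.
- by apply: iso_union (iso_refl _); exact: iso_root.
Qed.

End Iso.

(* [mso A n m]: formulas with [n] free first-order variables and [m] free set
   variables; a quantifier binds the variable of index 0. *)
Inductive mso (A : Type) : nat -> nat -> Type :=
| MLabel n m (a : A) (x : 'I_n) : mso A n m
| MChild n m (x y : 'I_n) : mso A n m
| MEq n m (x y : 'I_n) : mso A n m
| MIn n m (x : 'I_n) (X : 'I_m) : mso A n m
| MNot n m (p : mso A n m) : mso A n m
| MAnd n m (p q : mso A n m) : mso A n m
| MEx n m (p : mso A n.+1 m) : mso A n m
| MEx2 n m (p : mso A n m.+1) : mso A n m.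

Fixpoint sat (A : Type) (S : structure A) (n m : nat) (p : mso A n m) :
    n.-tuple S -> m.-tuple {set S} -> bool :=
  match p in mso _ n m return n.-tuple S -> m.-tuple {set S} -> bool with
  | MLabel _ _ a x => fun v _ => label a (tnth v x)
  | MChild _ _ x y => fun v _ => child (tnth v x) (tnth v y)
  | MEq _ _ x y => fun v _ => tnth v x == tnth v y
  | MIn _ _ x X => fun v V => tnth v x \in tnth V X
  | MNot _ _ p => fun v V => ~~ sat p v V
  | MAnd _ _ p q => fun v V => sat p v V && sat q v V
  | MEx _ _ p => fun v V => [exists d : S, sat p [tuple of d :: v] V]
  | MEx2 _ _ p => fun v V => [exists D : {set S}, sat p v [tuple of D :: V]]
  end.

(* The [i]-th copy of [x] belongs to the output if [phi_present i] holds at [x];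
   in [phi_child i j], variable 0 is the parent and variable 1 the child. *)
Record mso_transduction (A B : Type) := MsoTransduction {
  copies : nat;
  phi_dom : mso A 0 0;
  phi_present : 'I_copies -> mso A 1 0;
  phi_label : 'I_copies -> B -> mso A 1 0;
  phi_child : 'I_copies -> 'I_copies -> mso A 2 0
}.

Section Transduction.
Variables (A B : Type) (T : mso_transduction A B) (S : structure A).

Definition in_dom : bool := sat (phi_dom T) ([tuple] : 0.-tuple S) [tuple].

Definition present (x : S * 'I_(copies T)) : bool :=
  sat (phi_present x.2) [tuple x.1] [tuple].

Definition out_struct : structure B :=
  @Structure B {x : S * 'I_(copies T) | present x}
    (fun x y => sat (phi_child (val x).2 (val y).2)
                  [tuple (val x).1; (val y).1] [tuple])
    (fun b x => sat (phi_label (val x).2 b) [tuple (val x).1] [tuple]).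

End Transduction.

(* The output structure is required to be an unordered forest on the domain. *)
Definition mso_definable (A B : choiceType) (f : uforest A -> option (uforest B)) :
    Prop :=
  exists T : mso_transduction A B, forall h : uforest A,
    if in_dom T (ustruct h) then
      exists2 g, f h = Some g & iso (out_struct T (ustruct h)) (ustruct g)
    else f h = None.

(* Main.v *)
(* The formulas of the transduction are compiled into one deterministic bottom-up
   tree automaton with two marks, for the parent and for the child. Fix an input
   tree and a subtree s, and cut the output forest along the output nodes that
   come from s. Give such a node the colour consisting of its copy and of the
   states reached at the root of s when the node carries either mark: whether it
   is linked to a node outside s depends only on its colour. Since parents are
   unique, at most one node of each colour has a child outside s; call it a port.
   The components of the cut, grouped by the colour of their roots, are thus
   forests with boundedly many labelled holes (one below each port), which
   decompose into boundedly many one-hole contexts: these are the registers. The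
   state holds the shapes of the decompositions, the colours present in s, and a
   guess of what matters of the rest of the tree; the guess is checked at the root.
   At a binary node, the pieces of both subtrees and of the new output nodes are
   plugged into each other through their ports; a path goes through ports of
   pairwise distinct colours, so boundedly many rounds of substitution suffice. *)
Require Import Defs.
From HB Require Import structures.
From mathcomp Require Import all_boot generic_quotient.
From mathcomp Require Import boolp classical_sets.

Set Implicit Arguments.
Unset Strict Implicit.
Unset Printing Implicit Defensive.

(** * Unordered forests with holes as a commutative monoid *)

(** Which nodes of a subtree are ports depends on the tree outside it, which a bottom-up run has not
    yet seen; hence the guess. A fixed guess leaves only one possible outcome, so the output is a
    singleton although the automaton is nondeterministic. The pieces have unbounded content, but
    finitely many rules must prescribe how to combine them. The combination is therefore written
    once, over abstract operations [cops], and used in three carriers: in the algebra, where it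
    gives the meaning; in terms, where it gives the register updates; in a one-point carrier, where
    it gives the shapes stored in states. Homomorphisms between the carriers yield the correctness
    of the rules. On the semantic side, a forest is the solution of equations attached to the nodes
    of an acyclic graph; uniqueness of solutions replaces the manipulation of trees. *)

Section ForestAlgebra.
Variable A : choiceType.
Implicit Types (s t u : seq (tree A)) (f g h : hforest A).

Definition hpi s : hforest A := (\pi_(hforest A) s)%qT.
Definition hzero : hforest A := hpi [::].
Definition hhole : hforest A := hpi [:: Hole].
Definition hadd g h : hforest A := hpi (repr g ++ repr h).
Definition hnode (a : A) h : hforest A := hpi [:: Node a (repr h)].
Definition hsubst h g : hforest A := hpi (fsubst (repr h) (repr g)).
Definition hholes h : nat := nholes (repr h).

Lemma hpi_eq s t : feq s t -> hpi s = hpi t.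
Proof. by move/hforestP. Qed.

Lemma hpi_repr h : hpi (repr h) = h.
Proof. exact: reprK. Qed.

Lemma hforest_ind (P : hforest A -> Prop) : (forall s, P (hpi s)) -> forall h, P h.
Proof. by move=> Ps h; rewrite -(hpi_repr h). Qed.

Lemma hadd_pi s t : hadd (hpi s) (hpi t) = hpi (s ++ t).
Proof. by apply: hpi_eq; apply: feq_cat; exact: feq_repr. Qed.

Lemma hnode_pi a s : hnode a (hpi s) = hpi [:: Node a s].
Proof. by apply: hpi_eq; apply: feq_node; exact: feq_repr. Qed.

Lemma hsubst_pi s t : hsubst (hpi s) (hpi t) = hpi (fsubst s t).
Proof.
apply: hpi_eq; apply: feq_trans (feq_substl _ (feq_repr s)) _.
exact: feq_substr (feq_repr t).
Qed.

Lemma hholes_pi s : hholes (hpi s) = nholes s.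
Proof. exact/feq_nholes/feq_repr. Qed.

Lemma haddA : associative hadd.
Proof.
elim/hforest_ind=> s; elim/hforest_ind=> t; elim/hforest_ind=> u.
by rewrite !hadd_pi catA.
Qed.

Lemma haddC : commutative hadd.
Proof.
elim/hforest_ind=> s; elim/hforest_ind=> t.
by rewrite !hadd_pi; apply/hpi_eq/feq_catC.
Qed.

Lemma hadd0 : left_id hzero hadd.
Proof. by elim/hforest_ind=> s; rewrite hadd_pi. Qed.

HB.instance Definition _ :=
  Monoid.isComLaw.Build (hforest A) hzero hadd haddA haddC hadd0.

Lemma hholesD g h : hholes (hadd g h) = hholes g + hholes h.
Proof.
by elim/hforest_ind: g => s; elim/hforest_ind: h => t;
  rewrite hadd_pi !hholes_pi nholes_cat.
Qed.

Lemma hholes0 : hholes hzero = 0.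
Proof. by rewrite hholes_pi. Qed.

Lemma hholes_hole : hholes hhole = 1.
Proof. by rewrite hholes_pi. Qed.

Lemma hholes_node a h : hholes (hnode a h) = hholes h.
Proof. by elim/hforest_ind: h => s; rewrite hnode_pi !hholes_pi [LHS]addn0. Qed.

Lemma hholes_subst h g : hholes (hsubst h g) = hholes h * hholes g.
Proof.
elim/hforest_ind: h => s; elim/hforest_ind: g => t.
by rewrite hsubst_pi !hholes_pi nholes_subst.
Qed.

Lemma fsubst_cat s t u : fsubst (s ++ t) u = fsubst s u ++ fsubst t u.
Proof. by rewrite /fsubst map_cat flatten_cat. Qed.

Lemma fsubst_id s t : nholes s = 0 -> fsubst s t = s.
Proof.
elim: s => // x s IHs /eqP; rewrite addn_eq0 => /andP[/eqP x0 /eqP/IHs s0].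
rewrite /fsubst /= -/(fsubst s t) s0 -[RHS]cat1s; congr (_ ++ _).
move: x x0; apply: (@tree_nested_ind A
  (fun x => tholes x = 0 -> tsubst t x = [:: x])
  (fun s => nholes s = 0 -> fsubst s t = s)) => //.
- by move=> a c cP /cP /= cE; rewrite -/(fsubst c t) cE.
- move=> x c xP cP /eqP; rewrite addn_eq0 => /andP[/eqP/xP xE /eqP/cP cE].
  by rewrite /fsubst /= xE -/(fsubst c t) cE.
Qed.

Lemma fsubstA s t u : fsubst (fsubst s t) u = fsubst s (fsubst t u).
Proof.
elim: s => // x s IHs.
rewrite {2}/fsubst /= -/(fsubst s t) fsubst_cat IHs; congr (_ ++ _).
apply: (@tree_nested_ind A (fun x => fsubst (tsubst t x) u = tsubst (fsubst t u) x)
  (fun s => fsubst (fsubst s t) u = fsubst s (fsubst t u))) => //.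
- by move=> a c cP; rewrite /fsubst /= -!/(fsubst _ _) cP.
- by move=> y c yP cP; rewrite {2}/fsubst /= -/(fsubst c t) fsubst_cat cP yP.
Qed.

Lemma hsubst_id h g : hholes h = 0 -> hsubst h g = h.
Proof.
elim/hforest_ind: h => s; elim/hforest_ind: g => t; rewrite hholes_pi => s0.
by rewrite hsubst_pi fsubst_id.
Qed.

Lemma hsubstA f g h : hsubst (hsubst f g) h = hsubst f (hsubst g h).
Proof.
elim/hforest_ind: f => s; elim/hforest_ind: g => t; elim/hforest_ind: h => u.
by rewrite !hsubst_pi fsubstA.
Qed.

Lemma hsubstDl f g h : hsubst (hadd f g) h = hadd (hsubst f h) (hsubst g h).
Proof.
elim/hforest_ind: f => s; elim/hforest_ind: g => t; elim/hforest_ind: h => u.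
by rewrite hadd_pi !hsubst_pi hadd_pi fsubst_cat.
Qed.

Lemma hsubst_hole h : hsubst hhole h = h.
Proof.
by elim/hforest_ind: h => s; rewrite hsubst_pi /fsubst /= cats0.
Qed.

Lemma hsubst_node a g h : hsubst (hnode a g) h = hnode a (hsubst g h).
Proof.
elim/hforest_ind: g => s; elim/hforest_ind: h => t.
by rewrite hnode_pi !hsubst_pi hnode_pi.
Qed.

End ForestAlgebra.

Arguments hzero {A}.
Arguments hhole {A}.
Arguments hpi {A}.

Notation "\hsum_ ( i | P ) F" := (\big[@hadd _/hzero]_(i | P%B) F)
  (at level 41, F at level 41, i, P at level 50).

(** * Forests read from acyclic graphs *)

Section Acyclic.
Variables (N : finType) (R : rel N).

Definition acyclic := exists dep : N -> nat, forall x y, R x y -> dep x < dep y.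

Hypothesis Rac : acyclic.

Lemma acyclic_bounded : exists (dep : N -> nat) (m : nat),
  (forall x y, R x y -> dep x < dep y) /\ forall x, dep x < m.
Proof.
have [dep depR] := Rac; exists dep, (\max_x dep x).+1; split=> // x.
by rewrite ltnS; apply: leq_bigmax.
Qed.

Lemma acyclic_ind (P : N -> Prop) :
  (forall x, (forall y, R x y -> P y) -> P x) -> forall x, P x.
Proof.
move=> IH; have [dep [m [depR depm]]] := acyclic_bounded.
suff hP k : forall x, m <= k + dep x -> P x by move=> x; apply: (hP m); exact: leq_addr.
elim: k => [|k IHk] x mx; first by have := depm x; rewrite ltnNge mx.
by apply: IH => y /depR xy; apply: IHk; apply: leq_trans mx _;
  rewrite addSnnS leq_add2l.
Qed.

Lemma acyclic_connect x y : R x y -> ~~ connect R y x.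
Proof.
have [dep depR] := Rac; move=> /depR xy; apply/negP => /connectP[p].
move=> py xE; suff: dep y <= dep x by rewrite leqNgt xy.
rewrite xE; elim: p y {xy xE} py => //= z p IHp y /andP[/depR/ltnW yz /IHp zp].
exact: leq_trans yz zp.
Qed.
End Acyclic.

Lemma acyclic_sub (N N' : finType) (R : rel N) (R' : rel N') (f : N' -> N) :
  (forall x y, R' x y -> R (f x) (f y)) -> acyclic R -> acyclic R'.
Proof. by move=> fR [dep depR]; exists (dep \o f) => x y /fR/depR. Qed.

Section Read.
Variables (A : choiceType) (N : finType) (R : rel N).
Variables (lab : N -> option A) (xi : N -> hforest A).

(** [xi x] is what hangs below [x] besides its successors; it will carry the contents of ports.
    Unlabelled nodes read as the empty forest, so absent copies can stay in the graph. *)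
Definition reads (r : N -> hforest A) := forall x,
  r x = if lab x is Some a then hnode a (hadd (\hsum_(y | R x y) r y) (xi x))
        else hzero.

Fixpoint read_upto (d : nat) (x : N) : hforest A :=
  if d is d'.+1 then
    if lab x is Some a then
      hnode a (hadd (\hsum_(y | R x y) read_upto d' y) (xi x))
    else hzero
  else hzero.

(** Depths grow along edges and stay below [m], so the unfolding at [x] is stable after [m - dep x]
    rounds. *)
Lemma reads_exist : acyclic R -> exists r, reads r.
Proof.
case/acyclic_bounded=> dep [m [depR depm]].
suff stable d x : m <= d + dep x -> read_upto d x = read_upto d.+1 x.
  by exists (read_upto m) => x; rewrite stable // leq_addr.
elim: d x => [x mx|d IHd x mx]; first by have := depm x; rewrite ltnNge mx.
have step y : R x y -> read_upto d y = read_upto d.+1 y.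
  move/depR => xy; apply: IHd; apply: leq_trans mx _.
  by rewrite addSnnS leq_add2l.
transitivity (if lab x is Some a then
   hnode a (hadd (\hsum_(y | R x y) read_upto d.+1 y) (xi x)) else hzero) => //=.
by case: (lab x) => // a; congr hnode; congr hadd; exact: eq_bigr.
Qed.

Lemma reads_unique r r' : acyclic R -> reads r -> reads r' -> r =1 r'.
Proof.
move=> Rac rP r'P; apply: (acyclic_ind Rac) => x IH.
rewrite rP r'P; case: (lab x) => // a; congr hnode; congr hadd.
exact: eq_bigr.
Qed.

(** Chosen among the solutions, so that no proof of acyclicity has to be an argument. *)
Definition read : N -> hforest A :=
  if pselect (exists r, reads r) is left e then sval (cid e) else fun=> hzero.

Lemma readP : acyclic R -> reads read.
Proof.
by move/reads_exist=> e; rewrite /read; case: pselect => // e'; exact: (svalP (cid e')).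
Qed.

(* Sum the equations of [reads] over all nodes: every non-root occurs once on
   either side and cancels. *)
Lemma holes_read_roots : acyclic R -> (forall x x' y, R x y -> R x' y -> x = x') ->
  \sum_(x | [forall y, ~~ R y x]) hholes (read x) <= \sum_x hholes (xi x).
Proof.
move=> /readP rP Rinj.
have holes_le x : hholes (read x) <=
    \sum_(y | R x y) hholes (read y) + hholes (xi x).
  rewrite {1}rP; case: (lab x) => [a|]; last by rewrite hholes0.
  by rewrite hholes_node hholesD (big_morph _ (@hholesD A) (hholes0 A)).
have: \sum_x hholes (read x) <=
    \sum_x (\sum_(y | R x y) hholes (read y) + hholes (xi x)).
  by apply: leq_sum => x _; exact: holes_le.
rewrite big_split /= (exchange_big_dep predT) //=.
rewrite (bigID (fun x => [forall y, ~~ R y x])) /= addnC => le_sum.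
rewrite -(leq_add2l (\sum_(x | ~~ [forall y, ~~ R y x]) hholes (read x))).
apply: leq_trans le_sum _; rewrite leq_add2r.
rewrite (bigID (fun x => [forall y, ~~ R y x])) /= big1 ?add0n.
  apply: leq_sum => y /forallPn[x /negbNE xy].
  by rewrite (big_pred1 x) // => x'; apply/idP/eqP => [/Rinj-/(_ x xy)|->].
by move=> y /forallP yroot; rewrite big_pred0 // => x; rewrite (negbTE (yroot x)).
Qed.

End Read.

Lemma hsum_inj (A : choiceType) (N N' : finType) (f : N' -> N) (P : pred N)
    (F : N -> hforest A) : injective f -> (forall y, P y -> y \in codom f) ->
  \hsum_(y | P y) F y = \hsum_(v | P (f v)) F (f v).
Proof.
move=> f_inj Pf; rewrite -(big_map f P F).
rewrite -big_filter -[RHS]big_filter; apply: perm_big.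
apply: uniq_perm; rewrite ?filter_uniq ?index_enum_uniq ?(map_inj_uniq f_inj)
  ?index_enum_uniq //.
move=> y; rewrite !mem_filter mem_index_enum andbT;
  case: (boolP (P y)) => //= /Pf/codomP[v ->].
by rewrite (mem_map f_inj) mem_index_enum.
Qed.

(** The image of [f] is closed under successors, so the large reading composed with [f] solves the
    equations of the small graph. *)
Lemma read_embed (A : choiceType) (N N' : finType) (f : N' -> N) (R : rel N)
    (R' : rel N') lab lab' (xi : N -> hforest A) xi' :
  injective f -> acyclic R ->
  (forall u v, R (f u) (f v) = R' u v) ->
  (forall u y, R (f u) y -> y \in codom f) ->
  (forall u, lab (f u) = lab' u) -> (forall u, xi (f u) = xi' u) ->
  forall u, read R lab xi (f u) = read R' lab' xi' u.
Proof.
move=> f_inj Rac fR fcl flab fxi.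
have R'ac : acyclic R' by apply: (acyclic_sub (f := f)) Rac => x y; rewrite fR.
apply: reads_unique R'ac _ (readP _ _ R'ac) => u.
rewrite readP // flab; case: (lab' u) => // a; congr hnode; rewrite fxi.
rewrite (hsum_inj _ f_inj); last exact: fcl.
by congr hadd; apply: eq_bigl => v; rewrite fR.
Qed.

(** * Plugging the blocks of a partitioned graph into each other *)

Section Merge.
Variables (A : choiceType) (N Bk K Z : finType) (R : rel N) (lab : N -> option A).
Variables (blk : N -> Bk) (col : N -> Z) (link : rel Z) (opz att : pred Z).
Variables (ncol : Z -> K) (bp : pred N) (rho : K -> hforest A).

Hypothesis Rac : acyclic R.
Hypothesis Rinj : forall x x' y, R x y -> R x' y -> x = x'.
Hypothesis linkE : forall x y, link (col x) (col y) = R x y && (blk x != blk y).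
Hypothesis bpR : forall x y, R x y -> blk x != blk y -> bp x.
Hypothesis bp_op : forall x, opz (col x) -> bp x.
Hypothesis bp_inj : forall x x', bp x -> bp x' -> col x = col x' -> x = x'.
Hypothesis attE : forall x, (forall y, R y x -> blk y != blk x) ->
  att (col x) = [exists y, R y x].

Definition within : rel N := fun x y => R x y && (blk x == blk y).

Definition port_value (rho' : Z -> hforest A) (x : N) : hforest A :=
  if bp x then rho' (col x) else hzero.

(** A piece is read along the edges inside its block only; edges that leave the block are
    represented by the value of [rho'] at their source, a port. *)
Definition block_value (z : Z) (rho' : Z -> hforest A) : hforest A :=
  \hsum_(x | (col x == z) && [forall y, ~~ within y x])
     read within lab (port_value rho') x.

(** What belongs below the port of [z]: the pieces linked to it, themselves plugged recursively, and
    the outer hole if the port stays open. *)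
Fixpoint solve (F : Z -> (Z -> hforest A) -> hforest A) (d : nat) (z : Z) :
    hforest A :=
  if d is d'.+1 then
    hadd (\hsum_(z' | link z z') F z' (solve F d'))
         (if opz z then rho (ncol z) else hzero)
  else hzero.

Let RB := read R lab (fun x => if opz (col x) then rho (ncol (col x)) else hzero).

Let within_ac : acyclic within.
Proof. by apply: (@acyclic_sub _ _ R _ id) Rac => x y /andP[]. Qed.

Let ports_below x := [set col y | y : N & bp y && connect R x y].

Let ports_belowS x y : R x y -> ports_below y \subset ports_below x.
Proof.
move=> xy; apply/fintype.subsetP => z /imsetP[w]; rewrite !inE => /andP[bw yw] ->.
by apply: imset_f; rewrite !inE bw (connect_trans (connect1 xy)).
Qed.

Let ports_below_proper x y : bp x -> R x y ->
  #|ports_below y| < #|ports_below x|.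
Proof.
move=> bx xy; apply/proper_card/fintype.properP; split; first exact: ports_belowS.
exists (col x); first by apply: imset_f; rewrite !inE bx connect0.
apply/imsetP=> -[w]; rewrite !inE => /andP[bw yw] /(bp_inj bx bw) xw.
by have := acyclic_connect Rac xy; rewrite xw yw.
Qed.

(* A chain of nested ports meets pairwise distinct colours, so the number of
   ports below [x] bounds the number of unfoldings needed at [x]. *)
Lemma read_solve d x : #|ports_below x| <= d ->
  read within lab (port_value (solve block_value d)) x = RB x.
Proof.
elim: d x => [|d IHd] x; move: x; apply: (acyclic_ind Rac) => x IHx xd.
all: rewrite /RB readP // [RHS]readP // -/RB; case: (lab x) => // a; congr hnode.
all: have IHw y : R x y -> #|ports_below y| <= _ :=
  fun xy => leq_trans (subset_leq_card (ports_belowS xy)) xd.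
all: rewrite [X in _ = hadd X _](bigID (fun y => blk x == blk y)) /=.
all: rewrite -[RHS](haddA _ _ _); congr hadd;
  first by apply: eq_bigr => y /andP[xy _]; apply: IHx => //; exact: IHw.
- have nbx : ~~ bp x.
    apply/negP => bx; move: xd; rewrite leqn0 cards_eq0 => /eqP/setP/(_ (col x)).
    by rewrite inE => /negP[]; apply: imset_f; rewrite !inE bx connect0.
  rewrite big1 ?hadd0 /port_value ?(negbTE nbx).
    by rewrite ifN //; apply: contra nbx; exact: bp_op.
  by move=> y /andP[xy /(bpR xy)]; rewrite (negbTE nbx).
- rewrite /port_value; case: ifPn => [bx|nbx]; last first.
    rewrite big1 ?hadd0; first by rewrite ifN //; apply: contra nbx; exact: bp_op.
    by move=> y /andP[xy /(bpR xy)]; rewrite (negbTE nbx).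
  rewrite /=; congr hadd; rewrite /block_value.
  rewrite (exchange_big_dep predT) //= [RHS]big_mkcond /=; apply: eq_bigr => y _.
  case: ifPn => [/andP[xy xyb]|].
    rewrite (big_pred1 (col y)).
      by apply: IHd; rewrite -ltnS; apply: leq_trans (ports_below_proper bx xy) xd.
    move=> z /=; rewrite [col y == z]eq_sym; case: (z =P col y) => [->|];
      last by rewrite andbF.
    rewrite linkE xy xyb /=; apply/forallP => w; rewrite /within.
    apply/negP => /andP[wy]; rewrite (Rinj wy xy); exact/negP.
  move=> nxy; rewrite big_pred0 // => z; apply/negbTE/negP => /andP[xz /andP[/eqP yz
    _]].
  by move: xz; rewrite -yz linkE (negbTE nxy).
Qed.

(** A root of the graph is a root of its block that no crossing edge reaches, and by [attE] the
    latter depends on the place only. So the unattached pieces have exactly the roots of the graph,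
    and [read_solve] completes each of them; [#|Z|] rounds are enough since the colours of ports
    form a subset of [Z]. *)
Lemma merge_blocks (k : K) :
  \hsum_(z | (ncol z == k) && ~~ att z) block_value z (solve block_value #|Z|) =
  \hsum_(x | (ncol (col x) == k) && [forall y, ~~ R y x]) RB x.
Proof.
rewrite /block_value (exchange_big_dep predT) //= [RHS]big_mkcond /=.
apply: eq_bigr => x _; case: ifPn => [/andP[kx xroot]|nx].
  rewrite (big_pred1 (col x)); first by apply: read_solve; exact: max_card.
  move=> z /=; rewrite [col x == z]eq_sym; case: (z =P col x) => [->|];
    last by rewrite andbF.
  rewrite kx /= attE; last by move=> y; move/forallP/(_ y)/negbTE: xroot => ->.
  rewrite negb_exists xroot /=; apply/forallP => y.
  by rewrite /within (negbTE (forallP xroot y)).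
rewrite big_pred0 // => z; apply/negbTE; apply: contra nx => /andP[/andP[kz za]].
case/andP=> /eqP xz /forallP xb; move: kz za; rewrite -xz => /[dup] kz -> /=.
rewrite attE ?negb_exists // => y yx; have := xb y.
by rewrite /within yx eq_sym => /=; rewrite eq_sym.
Qed.

End Merge.

(** * Recognizability of MSO formulas *)

Inductive btree (A : Type) := BLeaf | BNode (a : A) (l r : btree A).
Arguments BLeaf {A}.

Fixpoint bforest (A : Type) (t : btree A) : seq (tree A) :=
  if t is BNode a l r then Node a (bforest l) :: bforest r else [::].

Fixpoint bstruct (A : eqType) (t : btree A) : structure A :=
  if t is BNode a l r then sunion (sroot a (bstruct l)) (bstruct r) else sempty A.

Lemma bstructE (A : eqType) (t : btree A) : bstruct t = fstruct (bforest t).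
Proof. by elim: t => //= a l -> r ->. Qed.

Section Positions.
Variables (A : eqType) (a : A) (l r : btree A).
Local Notation S := (bstruct (BNode a l r)).

Definition proot : S := inl None.
Definition pleft (u : bstruct l) : S := inl (Some u).
Definition pright (u : bstruct r) : S := inr u.

Lemma pleft_inj : injective pleft. Proof. by move=> u v []. Qed.
Lemma pright_inj : injective pright. Proof. by move=> u v []. Qed.

Lemma exists_position (P : pred S) : [exists z, P z] =
  [|| P proot, [exists z, P (pleft z)] | [exists z, P (pright z)]].
Proof.
apply/existsP/or3P => [[[[z|]|z] Pz]|[Pz|/existsP[z Pz]|/existsP[z Pz]]].
- by apply: Or32; apply/existsP; exists z.
- exact: Or31.
- by apply: Or33; apply/existsP; exists z.
- by exists proot.
- by exists (pleft z).
- by exists (pright z).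
Qed.
End Positions.

Section Automata.
Variable A : eqType.
Implicit Type t : btree A.

(** Only the states are finite; the marks may be of any type, in particular functions that assign a
    bit to each free variable. *)
Record dta (W : Type) := Dta {
  dstate : finType;
  dinit : dstate;
  dstep : A -> W -> dstate -> dstate -> dstate
}.

Fixpoint drun W (D : dta W) t : (bstruct t -> W) -> dstate D :=
  if t is BNode a l r then fun w => dstep a (w (proot a l r))
    (drun D (fun u => w (pleft a r u))) (drun D (fun u => w (pright a l u)))
  else fun=> dinit D.

Definition comap_dta W W' (f : W -> W') (D : dta W') : dta W :=
  Dta (dinit D) (fun a w => dstep a (f w)).

Lemma drun_comap W W' (f : W -> W') (D : dta W') t (w : bstruct t -> W) :
  drun (comap_dta f D) w = drun D (f \o w).
Proof. by elim: t w => //= a l IHl r IHr w; rewrite IHl IHr. Qed.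

Definition pair_dta W (D D' : dta W) : dta W :=
  Dta (dinit D, dinit D')
    (fun a w p q => (dstep a w p.1 q.1, dstep a w p.2 q.2)).

Lemma drun_pair W (D D' : dta W) t (w : bstruct t -> W) :
  drun (pair_dta D D') w = (drun D w, drun D' w).
Proof. by elim: t w => //= a l IHl r IHr w; rewrite IHl IHr. Qed.

Definition family_dta W (I : finType) (D : I -> dta W) : dta W :=
  @Dta W {dffun forall i, dstate (D i)} [ffun i => dinit (D i)]
    (fun a w p q => [ffun i => dstep a w (p i) (q i)]).

Lemma drun_family W (I : finType) (D : I -> dta W) t (w : bstruct t -> W) i :
  (drun (family_dta D) w) i = drun (D i) w.
Proof. by elim: t w => [|a l IHl r IHr] w /=; rewrite ffunE ?IHl ?IHr. Qed.

(* Besides the state without any extra mark, collects the states obtained by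
   marking one position. *)
Definition point_dta W (D : dta (W * bool)) : dta W :=
  @Dta W (dstate D * {set dstate D})%type (dinit D, finset.set0)
    (fun a w p q => (dstep a (w, false) p.1 q.1,
       dstep a (w, true) p.1 q.1
         |: ((fun s => dstep a (w, false) s q.1) @: p.2
         :|: dstep a (w, false) p.1 @: q.2))).

Lemma drun_point W (D : dta (W * bool)) t (w : bstruct t -> W) :
  drun (point_dta D) w = (drun D (fun u => (w u, false)),
    [set drun D (fun u => (w u, d == u)) | d : bstruct t]).
Proof.
elim: t w => [|a l IHl r IHr] w /=.
  by congr pair; apply/setP => q; rewrite inE; apply/esym/negP => /imsetP[[]].
rewrite IHl IHr /=; congr pair; apply/setP => q; rewrite !inE.
apply/or3P/imsetP => [[/eqP ->|/imsetP[_ /imsetP[u _ ->] ->]|/imsetP[_ /imsetP[u _ ->]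
  ->]]|].
- by exists (proot a l r).
- by exists (pleft a r u).
- by exists (pright a l u).
case=> -[[u|]|u] _ ->.
- by apply: Or32; apply: imset_f; apply/imsetP; exists u.
- by apply: Or31; apply/eqP.
- by apply: Or33; apply: imset_f; apply/imsetP; exists u.
Qed.

(** Subset construction for set quantifiers: all states reachable by some placement of the extra
    mark. *)
Definition power_dta W (D : dta (W * bool)) : dta W :=
  @Dta W {set dstate D} [set dinit D]
    (fun a w P Q => [set q | [exists b, exists p1 in P, exists p2 in Q,
       q == dstep a (w, b) p1 p2]]).

Lemma drun_power W (D : dta (W * bool)) t (w : bstruct t -> W) :
  drun (power_dta D) w =
    [set drun D (fun u => (w u, u \in X)) | X : {set bstruct t}].
Proof.
elim: t w => [|a l IHl r IHr] w /=.
  apply/setP=> q; rewrite inE; apply/eqP/imsetP => [->|[]//].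
  by exists finset.set0.
rewrite IHl IHr; apply/setP => q; rewrite inE; apply/existsP/imsetP.
  case=> b /existsP[_ /andP[/imsetP[X _ ->]]].
  case/existsP=> [_ /andP[/imsetP[Y _ ->] /eqP ->]].
  exists [set u : bstruct (BNode a l r) | match u with
    | inl None => b | inl (Some u) => u \in X | inr u => u \in Y end] => //.
  rewrite inE; congr dstep; congr drun; apply/funext => u; by rewrite inE.
case=> X _ ->; exists (proot a l r \in X).
apply/existsP; exists (drun D (fun u => (w (pleft a r u), pleft a r u \in X))).
apply/andP; split.
  apply/imsetP; exists [set u | pleft a r u \in X] => //.
  by congr drun; apply/funext => u; rewrite inE.
apply/existsP; exists (drun D (fun u => (w (pright a l u), pright a l u \in X))).
rewrite eqxx andbT; apply/imsetP; exists [set u | pright a l u \in X] => //.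
by congr drun; apply/funext => u; rewrite inE.
Qed.

Definition exists_dta W (g : A -> W -> bool) : dta W :=
  @Dta W bool false (fun a w p q => [|| g a w, p | q]).

Fixpoint blabel t : bstruct t -> A :=
  if t is BNode a l r then fun u : bstruct (BNode a l r) => match u with
    | inl None => a | inl (Some u) => blabel u | inr u => blabel u end
  else fun u : void => match u with end.

Lemma labelE t (a : A) (u : bstruct t) : label a u = (blabel u == a).
Proof.
by elim: t u => [[]|b l IHl r IHr] [[u|]|u] //=; rewrite eq_sym.
Qed.

Lemma drun_exists W (g : A -> W -> bool) t (w : bstruct t -> W) :
  drun (exists_dta g) w = [exists u, g (blabel u) (w u)].
Proof.
elim: t w => [|a l IHl r IHr] w; first by apply/esym/existsP => -[[]].
by rewrite exists_position /= IHl IHr.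
Qed.

(* The first component tells whether the child mark is on a top-level node. *)
Definition child_dta W (x y : W -> bool) : dta W :=
  @Dta W (bool * bool)%type (false, false)
    (fun _ w p q => (y w || q.1, [|| x w && p.1, p.2 | q.2])).

Lemma drun_child W (x y : W -> bool) t (w : bstruct t -> W) :
  drun (child_dta x y) w =
    ([exists v, [forall u, ~~ child u v] && y (w v)],
     [exists u, exists v, [&& child u v, x (w u) & y (w v)]]).
Proof.
elim: t w => [|a l IHl r IHr] w.
  congr pair; apply/esym/existsP => -[[]].
rewrite !exists_position [LHS]/= IHl IHr; congr pair; last first.
  congr [|| _, _ | _].
  - rewrite [X in [|| _, _ | X]](_ : _ = false) ?orbF; last by apply/negbTE/existsPn.
    apply/andP/existsP => [[xw /existsP[v /andP[vroot yw]]]|[v /and3P[vroot xw yw]]].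
      by exists v; rewrite /= vroot xw.
    by split=> //; apply/existsP; exists v; rewrite yw andbT.
  - apply: eq_existsb => u; rewrite exists_position /=.
    by rewrite [X in _ || X](_ : _ = false) ?orbF //; apply/negbTE/existsPn.
  - apply: eq_existsb => u; rewrite exists_position /=.
    by rewrite [X in X || _](_ : _ = false) //; apply/negbTE/existsPn.
congr orb; last rewrite [X in _ = X || _](_ : _ = false) /=.
- rewrite (_ : [forall u, _] = true) //; apply/forallP => -[[u|]|u] //.
- apply: eq_existsb => v; congr andb; apply/forallP/forallP => vroot u.
    by case: u => [[u|]|u] //; exact: vroot.
  exact: (vroot (inr u)).
(* No node of [l] is top-level: one without a parent in [l] is a child of the new root. *)
- apply/negbTE/existsPn => v; apply/negP => /andP[/forallP vroot _].
  have := vroot (inl None); rewrite /= => /forallPn[u /negbNE uv].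
  by have := vroot (inl (Some u)); rewrite /= uv.
Qed.

Definition mso_marks n m t (v : n.-tuple (bstruct t))
    (V : m.-tuple {set bstruct t}) (u : bstruct t) : ('I_n -> bool) * ('I_m -> bool) :=
  (fun i => tnth v i == u, fun j => u \in tnth V j).

Definition cons_mark n (w : 'I_n -> bool) (b : bool) (i : 'I_n.+1) : bool :=
  if unlift ord0 i is Some i' then w i' else b.

Lemma cons_markE n (T : Type) (f : T -> bool) (x : T) (v : n.-tuple T) :
  cons_mark (fun i => f (tnth v i)) (f x) = (fun i => f (tnth [tuple of x :: v] i)).
Proof.
apply/funext => i; rewrite /cons_mark; case: (unliftP ord0 i) => [i' ->|->] //.
by rewrite tnthS.
Qed.

(** Only markings that come from valuations are considered, so no automaton has to check that a
    first-order mark sits on exactly one node. *)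
Definition recognized n m (p : mso A n m) := exists (D : dta (('I_n -> bool) * ('I_m
  -> bool)))
  (acc : dstate D -> bool), forall t (v : n.-tuple (bstruct t)) V,
  sat p v V = acc (drun D (mso_marks v V)).

(** The Doner-Thatcher-Wright translation. [point_dta] and [power_dta] handle the two quantifiers;
    [cons_mark] inserts the mark of the bound variable at index 0. *)
Lemma mso_recognized n m (p : mso A n m) : recognized p.
Proof.
elim: p => {n m} [n m a x|n m x y|n m x y|n m x X|n m p [D [acc DP]]
  |n m p [D [acc DP]] q [D' [acc' DP']]|n m p [D [acc DP]]|n m p [D [acc DP]]].
- exists (exists_dta (fun b w => (b == a) && w.1 x)), id => t v V.
  rewrite drun_exists /= labelE; apply/idP/existsP => [va|[u /andP[ua /eqP ->]]] //.
  by exists (tnth v x); rewrite va eqxx.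
- exists (child_dta (fun w => w.1 x) (fun w => w.1 y)), snd => t v V.
  rewrite drun_child /=; apply/idP/existsP.
    by move=> vxy; exists (tnth v x); apply/existsP; exists (tnth v y);
      rewrite vxy !eqxx.
  by case=> u /existsP[u' /and3P[uu' /eqP -> /eqP ->]].
- exists (exists_dta (fun b w => w.1 x && w.1 y)), id => t v V.
  rewrite drun_exists /=; apply/idP/existsP => [/eqP vxy|[u /andP[/eqP -> /eqP ->]]] //.
  by exists (tnth v x); rewrite vxy eqxx.
- exists (exists_dta (fun b w => w.1 x && w.2 X)), id => t v V.
  rewrite drun_exists /=; apply/idP/existsP => [vX|[u /andP[/eqP -> ->]]] //.
  by exists (tnth v x); rewrite vX eqxx.
- by exists D, (fun q => ~~ acc q) => t v V /=; rewrite DP.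
- exists (pair_dta D D'), (fun q : dstate D * dstate D' => acc q.1 && acc' q.2) => t v
  V.
  by rewrite drun_pair /= DP DP'.
- exists (point_dta (comap_dta (fun wb => (cons_mark wb.1.1 wb.2, wb.1.2)) D)).
  exists (fun q : dstate D * {set dstate D} => [exists s in q.2, acc s]) => t v V.
  rewrite drun_point /=; apply/existsP/existsP => [[d pd]|[_ /andP[/imsetP[d _ ->]]]].
    exists (drun D (mso_marks [tuple of d :: v] V)); rewrite -DP pd andbT.
    apply/imsetP; exists d => //; rewrite drun_comap; congr drun.
    by apply/funext => u /=; rewrite (cons_markE (fun z => z == u)).
  move=> pd; exists d; rewrite DP; apply: etrans pd; congr acc.
  rewrite drun_comap; congr drun; apply/funext => u /=.
  by rewrite (cons_markE (fun z => z == u)).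
- exists (power_dta (comap_dta (fun wb => (wb.1.1, cons_mark wb.1.2 wb.2)) D)).
  exists (fun q : {set dstate D} => [exists s in q, acc s]) => t v V.
  rewrite drun_power /=; apply/existsP/existsP => [[d pd]|[_ /andP[/imsetP[d _ ->]]]].
    exists (drun D (mso_marks v [tuple of d :: V])); rewrite -DP pd andbT.
    apply/imsetP; exists d => //; rewrite drun_comap; congr drun.
    by apply/funext => u /=; rewrite (cons_markE (fun z : {set _} => u \in z)).
  move=> pd; exists d; rewrite DP; apply: etrans pd; congr acc.
  rewrite drun_comap; congr drun; apply/funext => u /=.
  by rewrite (cons_markE (fun z : {set _} => u \in z)).
Qed.

End Automata.

(** * One automaton with two marks for a whole transduction *)

Definition mark2 (A : eqType) (t : btree A) (x y : option (bstruct t)) (u : bstruct t) :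
  bool * bool := (x == Some u, y == Some u).

Section OutputForest.
Variables (A : Type) (B : finType) (T : mso_transduction A B).
Local Notation n := (copies T).

(** Absent copies get no label, and [present_child] gives them no edges; the output thus becomes a
    graph on all pairs of a node and a copy. *)
Definition pick_label (S : structure A) (x : S) (i : 'I_n) : option B :=
  if present (T := T) (x, i) then [pick b | sat (phi_label i b) [tuple x] [tuple]]
  else None.

Definition present_child (S : structure A) (x y : S) (i j : 'I_n) : bool :=
  [&& present (T := T) (x, i), present (T := T) (y, j)
    & sat (phi_child i j) [tuple x; y] [tuple]].

End OutputForest.

Section Compile.
Variables (A : eqType) (B : finType) (T : mso_transduction A B).
Local Notation n := (copies T).

Definition mso_dta k (p : mso A k 0) := sval (cid (mso_recognized p)).
Definition mso_acc k (p : mso A k 0) : dstate (mso_dta p) -> bool :=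
  sval (cid (svalP (cid (mso_recognized p)))).

(* [f] selects, for each free variable, the mark that encodes it. *)
Definition marks_dta k (p : mso A k 0) (f : 'I_k -> bool * bool -> bool) : dta A (bool
  * bool) :=
  comap_dta (fun w => (f^~ w, fun=> false)) (mso_dta p).

Lemma drun_marks k (p : mso A k 0) f t (v : k.-tuple (bstruct t)) x y :
  (forall i u, f i (mark2 x y u) = (tnth v i == u)) ->
  mso_acc (drun (marks_dta p f) (mark2 x y)) = sat p v [tuple].
Proof.
move=> fv; rewrite (svalP (cid (svalP (cid (mso_recognized p))))) -/(mso_acc _).
congr mso_acc; rewrite drun_comap; congr drun; apply/funext => u /=.
by congr pair; apply/funext => i; [rewrite fv | case: i].
Qed.

Lemma drun_marks_family k (I : finType) (p : I -> mso A k 0) f t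
    (v : k.-tuple (bstruct t)) x y j :
  (forall i u, f i (mark2 x y u) = (tnth v i == u)) ->
  mso_acc ((drun (family_dta (fun i => marks_dta (p i) f)) (mark2 x y)) j) =
  sat (p j) v [tuple].
Proof.
by move=> fv; rewrite -(drun_marks _ fv); congr mso_acc;
  exact: (drun_family (fun i => marks_dta (p i) f)).
Qed.

Lemma transduction_dta : exists (D : dta A (bool * bool)) (dom : dstate D -> bool)
    (lb : 'I_n -> dstate D -> option B) (ch : 'I_n -> 'I_n -> dstate D -> bool),
  forall t, [/\ dom (drun D (mark2 (t := t) None None)) = in_dom T (bstruct t),
    forall (x : bstruct t) i, lb i (drun D (mark2 (Some x) None)) = pick_label (T :=
      T) x i
  & forall (x y : bstruct t) i j,
      ch i j (drun D (mark2 (Some x) (Some y))) = present_child (T := T) x y i j].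
Proof.
pose f0 (i : 'I_0) (w : bool * bool) := false.
pose fx (i : 'I_1) (w : bool * bool) := w.1.
pose fy (i : 'I_1) (w : bool * bool) := w.2.
pose fxy (i : 'I_2) (w : bool * bool) := if i == ord0 then w.1 else w.2.
pose Dd := marks_dta (phi_dom T) f0.
(* Presence is compiled once for each mark, because both endpoints of an edge must be present. *)
pose Dx := family_dta (fun i : 'I_n => marks_dta (phi_present i) fx).
pose Dy := family_dta (fun i : 'I_n => marks_dta (phi_present i) fy).
pose Dl := family_dta (fun k : 'I_n * B => marks_dta (phi_label k.1 k.2) fx).
pose Dc := family_dta (fun k : 'I_n * 'I_n => marks_dta (phi_child k.1 k.2) fxy).
exists (pair_dta Dd (pair_dta (pair_dta Dx Dy) (pair_dta Dl Dc))).
exists (fun q : dstate Dd * (dstate Dx * dstate Dy * (dstate Dl * dstate Dc)) =>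
  mso_acc q.1).
exists (fun i (q : dstate Dd * (dstate Dx * dstate Dy * (dstate Dl * dstate Dc))) =>
  if mso_acc (q.2.1.1 i) then [pick b | mso_acc (q.2.2.1 (i, b))] else None).
exists (fun i j (q : dstate Dd * (dstate Dx * dstate Dy * (dstate Dl * dstate Dc))) =>
  [&& mso_acc (q.2.1.1 i), mso_acc (q.2.1.2 j) & mso_acc (q.2.2.2 (i, j))]).
have fxP t (x : bstruct t) y (i : 'I_1) u :
  fx i (mark2 (Some x) y u) = (tnth [tuple x] i == u) by rewrite (ord1 i).
have fyP t x (y : bstruct t) (i : 'I_1) u :
  fy i (mark2 x (Some y) u) = (tnth [tuple y] i == u) by rewrite (ord1 i).
have fxyP t (x y : bstruct t) (i : 'I_2) u :
  fxy i (mark2 (Some x) (Some y) u) = (tnth [tuple x; y] i == u).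
  by case: i => -[|[|//]] //=.
move=> t; split=> [|x i|x y i j]; rewrite !drun_pair /= /Dx /Dy /Dl /Dc.
- by apply: drun_marks => -[].
- have /= -> := drun_marks_family (@phi_present _ _ T) i (fxP _ t x None).
  rewrite /pick_label /present /=; case: ifP => // _; apply: eq_pick => b.
  exact: (drun_marks_family (fun k : 'I_n * B => phi_label k.1 k.2) (i, b) (fxP _ t x
    None)).
- have /= -> := drun_marks_family (@phi_present _ _ T) i (fxP _ t x (Some y)).
  have /= -> := drun_marks_family (@phi_present _ _ T) j (fyP _ t (Some x) y).
  by have /= -> := drun_marks_family (fun k : 'I_n * 'I_n => phi_child k.1 k.2)
    (i, j) (fxyP _ t x y).
Qed.

End Compile.

(** * Multi-hole forests in normal form *)

Section NormalForms.
Variable A : Type.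

Record cops (V : bool -> Type) := Cops {
  czero : V false;
  chole : V true;
  croot : A -> V true;
  cadd00 : V false -> V false -> V false;
  cadd01 : V false -> V true -> V true;
  capp : V true -> V false -> V false;
  ccomp : V true -> V true -> V true
}.

Record chom V W (O : cops V) (O' : cops W) (phi : forall b, V b -> W b) : Prop := Chom {
  chom_zero : phi _ (czero O) = czero O';
  chom_hole : phi _ (chole O) = chole O';
  chom_root a : phi _ (croot O a) = croot O' a;
  chom_add00 f g : phi _ (cadd00 O f g) = cadd00 O' (phi _ f) (phi _ g);
  chom_add01 f C : phi _ (cadd01 O f C) = cadd01 O' (phi _ f) (phi _ C);
  chom_app C f : phi _ (capp O C f) = capp O' (phi _ C) (phi _ f);
  chom_comp C D : phi _ (ccomp O C D) = ccomp O' (phi _ C) (phi _ D)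
}.

(* A multi-hole forest cut into one-hole contexts: [Lf C z] is C[X_z] and
   [Br C s t] is C[s + t], where X_z is a hole labelled by [z]. *)
Inductive ctree (V : bool -> Type) (Z : Type) :=
| Lf (C : V true) (z : Z)
| Br (C : V true) (s t : ctree V Z).

Inductive nform (V : bool -> Type) (Z : Type) :=
| Cst (f : V false)
| Tr (t : ctree V Z).

Arguments Cst {V Z}.
Arguments Tr {V Z}.

Section Operations.
Variables (V : bool -> Type) (O : cops V).

Definition tapp Z (C : V true) (t : ctree V Z) : ctree V Z :=
  match t with
  | Lf D z => Lf (ccomp O C D) z
  | Br D s t => Br (ccomp O C D) s t
  end.

Definition tadd Z (f : V false) (t : ctree V Z) : ctree V Z :=
  match t with
  | Lf D z => Lf (cadd01 O f D) z
  | Br D s t => Br (cadd01 O f D) s t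
  end.

Definition napp Z (C : V true) (m : nform V Z) : nform V Z :=
  match m with
  | Cst f => Cst (capp O C f)
  | Tr t => Tr (tapp C t)
  end.

(** A constant is absorbed by the top context; only the sum of two trees creates a new context. *)
Definition nadd Z (m m' : nform V Z) : nform V Z :=
  match m, m' with
  | Cst f, Cst g => Cst (cadd00 O f g)
  | Cst f, Tr t => Tr (tadd f t)
  | Tr s, Cst g => Tr (tadd g s)
  | Tr s, Tr t => Tr (Br (chole O) s t)
  end.

Definition nzero Z : nform V Z := Cst (czero O).
Definition nvar Z (z : Z) : nform V Z := Tr (Lf (chole O) z).

Fixpoint tsub Z Z' (sigma : Z -> nform V Z') (t : ctree V Z) : nform V Z' :=
  match t with
  | Lf C z => napp C (sigma z)
  | Br C s t => napp C (nadd (tsub sigma s) (tsub sigma t))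
  end.

Definition nsub Z Z' (sigma : Z -> nform V Z') (m : nform V Z) : nform V Z' :=
  match m with
  | Cst f => Cst f
  | Tr t => tsub sigma t
  end.

Fixpoint tground Z (t : ctree V Z) : V false :=
  match t with
  | Lf C _ => capp O C (czero O)
  | Br C s t => capp O C (cadd00 O (tground s) (tground t))
  end.

Definition nground Z (m : nform V Z) : V false :=
  match m with
  | Cst f => f
  | Tr t => tground t
  end.

Fixpoint csize Z (t : ctree V Z) : nat :=
  if t is Br _ s t then (csize s + csize t).+1 else 1.

Fixpoint tleaves Z (t : ctree V Z) : nat :=
  if t is Br _ s t then tleaves s + tleaves t else 1.

(** Turns a bound on the number of holes into a bound on the number of contexts. *)
Lemma csizeE Z (t : ctree V Z) : (csize t).+1 = (tleaves t).*2.
Proof. by elim: t => //= _ s IHs t IHt; rewrite doubleD -IHs -IHt addSn addnS. Qed.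

(** Keeps the shapes in a finite set whatever the arguments of a rule are; by [cut_value_small] it
    changes nothing on the pieces of an output forest. *)
Definition clip Z (M : nat) (m : nform V Z) : nform V Z :=
  if m is Tr t then if csize t <= M then m else nzero Z else m.

Fixpoint contexts Z (t : ctree V Z) : seq (V true) :=
  match t with
  | Lf C _ => [:: C]
  | Br C s t => C :: contexts s ++ contexts t
  end.

Lemma size_contexts Z (t : ctree V Z) : size (contexts t) = csize t.
Proof. by elim: t => //= C s IHs t IHt; rewrite size_cat IHs IHt. Qed.

(** Contexts are stored in preorder, a constant in every register of sort [false]; all other
    registers are padded. *)
Definition register Z (m : nform V Z) (k : nat) (b : bool) : V b :=
  if b is true then
    if m is Tr t then nth (chole O) (contexts t) k else chole O
  else if m is Cst f then f else czero O.

End Operations.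

Section Map.
Variables (V W : bool -> Type) (O : cops V) (O' : cops W) (phi : forall b, V b -> W b).

Fixpoint tmap Z (t : ctree V Z) : ctree W Z :=
  match t with
  | Lf C z => Lf (phi C) z
  | Br C s t => Br (phi C) (tmap s) (tmap t)
  end.

Definition nmap Z (m : nform V Z) : nform W Z :=
  match m with
  | Cst f => Cst (phi f)
  | Tr t => Tr (tmap t)
  end.

Hypothesis phiP : chom O O' phi.

Lemma nmap_zero Z : nmap (nzero O Z) = nzero O' Z.
Proof. by rewrite /= (chom_zero phiP). Qed.

Lemma nmap_var Z (z : Z) : nmap (nvar O z) = nvar O' z.
Proof. by rewrite /nvar /= (chom_hole phiP). Qed.

Lemma nmap_app Z C (m : nform V Z) : nmap (napp O C m) = napp O' (phi C) (nmap m).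
Proof.
by case: m => [f|[D z|D s t]] /=; rewrite ?(chom_app phiP) ?(chom_comp phiP).
Qed.

Lemma nmap_add Z (m m' : nform V Z) : nmap (nadd O m m') = nadd O' (nmap m) (nmap m').
Proof.
case: m m' => [f|s] [g|t] /=; rewrite ?(chom_add00 phiP) ?(chom_hole phiP) //.
- by case: t => [D z|D s t] /=; rewrite (chom_add01 phiP).
- by case: s => [D z|D s t] /=; rewrite (chom_add01 phiP).
Qed.

Lemma nmap_sub Z Z' (sigma : Z -> nform V Z') m :
  nmap (nsub O sigma m) = nsub O' (fun z => nmap (sigma z)) (nmap m).
Proof.
case: m => //=; elim=> [C z|C s IHs t IHt] /=; first by rewrite nmap_app.
by rewrite nmap_app nmap_add IHs IHt.
Qed.

Lemma nmap_ground Z (m : nform V Z) : phi (nground O m) = nground O' (nmap m).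
Proof.
case: m => //=; elim=> [C z|C s IHs t IHt] /=.
  by rewrite (chom_app phiP) (chom_zero phiP).
by rewrite (chom_app phiP) (chom_add00 phiP) IHs IHt.
Qed.

Lemma csize_map Z (t : ctree V Z) : csize (tmap t) = csize t.
Proof. by elim: t => //= C s -> t ->. Qed.

Lemma nmap_clip Z M (m : nform V Z) : nmap (clip O M m) = clip O' M (nmap m).
Proof.
by case: m => //= t; rewrite csize_map; case: ifP => //= _; rewrite (chom_zero phiP).
Qed.

Lemma contexts_map Z (t : ctree V Z) : contexts (tmap t) = map (@phi true) (contexts t).
Proof. by elim: t => //= C s -> t ->; rewrite map_cat. Qed.

Lemma register_map Z (m : nform V Z) k b :
  phi (register O m k b) = register O' (nmap m) k b.
Proof.
case: b; case: m => //= t; rewrite ?(chom_hole phiP) ?(chom_zero phiP) //.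
rewrite contexts_map; case: (ltnP k (size (contexts t))) => kt.
  by rewrite (nth_map (chole O)).
by rewrite !nth_default ?size_map // (chom_hole phiP).
Qed.

End Map.

Definition nshape V Z (m : nform V Z) : nform (fun=> unit) Z := nmap (fun b _ => tt) m.

Section Fill.
Variables (V : bool -> Type) (O : cops V).

Fixpoint fill_tree Z (sh : ctree (fun=> unit) Z) (k : nat) (g : nat -> V true) :
    ctree V Z :=
  match sh with
  | Lf _ z => Lf (g k) z
  | Br _ s t => Br (g k) (fill_tree s k.+1 g) (fill_tree t (k.+1 + csize s) g)
  end.

Definition fill Z (sh : nform (fun=> unit) Z) (g : nat -> forall b, V b) : nform V Z :=
  match sh with
  | Cst _ => Cst (g 0 false)
  | Tr t => Tr (fill_tree t 0 (fun k => g k true))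
  end.

Lemma fill_treeP Z (t : ctree V Z) k g :
  (forall i, i < csize t -> g (k + i) = nth (chole O) (contexts t) i) ->
  fill_tree (tmap (W := fun=> unit) (fun b _ => tt) t) k g = t.
Proof.
elim: t k => [C z|C s IHs t IHt] k gP /=; first by rewrite -[k]addn0 gP.
congr Br; first by rewrite -[k]addn0 gP.
- apply: IHs => i si; rewrite addSnnS gP; last by rewrite ltnS ltn_addr.
  by rewrite /= nth_cat size_contexts si.
- apply: IHt => i ti; rewrite csize_map -addnA addSnnS gP;
  last by rewrite ltnS ltn_add2l.
  by rewrite /= nth_cat size_contexts ltnNge leq_addr /= addKn.
Qed.

(** A constant reads register 0 and a tree those below [csize t <= M]; indices up to [M] serve both,
    whence ['I_M.+1] in [cell]. *)
Lemma fill_register Z (m : nform V Z) (M : nat) (g : nat -> forall b, V b) :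
  (if m is Tr t then csize t <= M else true) ->
  (forall k b, k <= M -> g k b = register O m k b) -> fill (nshape m) g = m.
Proof.
case: m => [f|t] /= tM gP; first by rewrite gP.
by rewrite fill_treeP // => i /leq_trans-/(_ _ tM)/ltnW; apply: gP.
Qed.

End Fill.

Lemma nmap_fill V W (phi : forall b, V b -> W b) Z (sh : nform (fun=> unit) Z) g :
  nmap phi (fill sh g) = fill sh (fun k b => phi b (g k b)).
Proof.
case: sh => //= t; congr Tr.
by elim: t 0 => //= C s IHs t IHt k; rewrite IHs IHt.
Qed.

Definition unit_cops : cops (fun=> unit) :=
  @Cops (fun=> unit) tt tt (fun=> tt) (fun _ _ => tt) (fun _ _ => tt)
    (fun _ _ => tt) (fun _ _ => tt).

Lemma chom_unit V (O : cops V) : chom O unit_cops (fun b _ => tt).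
Proof. by []. Qed.

Section Merge.
Variables (V : bool -> Type) (O : cops V) (Z K : finType).
Variables (link : rel Z) (opz att : pred Z) (ncol : Z -> K).
Variable F : Z -> (Z -> nform V K) -> nform V K.

(** The recursion of [solve] on normal forms: an open port contributes the variable of its new
    colour. *)
Fixpoint nsolve (d : nat) (z : Z) : nform V K :=
  if d is d'.+1 then
    nadd O (\big[nadd O (Z:=K)/nzero O K]_(z' | link z z') F z' (nsolve d'))
           (if opz z then nvar O (ncol z) else nzero O K)
  else nzero O K.

Definition nmerge (k : K) : nform V K :=
  \big[nadd O (Z:=K)/nzero O K]_(z | (ncol z == k) && ~~ att z) F z (nsolve #|Z|).

End Merge.

Lemma nmap_merge V W (O : cops V) (O' : cops W) phi (Z K : finType)
    (link : rel Z) (opz att : pred Z) (ncol : Z -> K) F F' k :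
  chom O O' phi ->
  (forall z sigma, nmap phi (F z sigma) = F' z (fun y => nmap phi (sigma y))) ->
  nmap phi (nmerge O link opz att ncol F k) = nmerge O' link opz att ncol F' k.
Proof.
move=> phiP FP.
have bigP := big_morph (@nmap _ _ phi K) (@nmap_add _ _ _ _ _ phiP K) (nmap_zero phiP
  _).
have solveP d z : nmap phi (nsolve O link opz ncol F d z) = nsolve O' link opz ncol F'
  d z.
  elim: d z => [|d IHd] z /=; first exact: (nmap_zero phiP).
  rewrite (nmap_add phiP) bigP; congr nadd.
    by apply: eq_bigr => z' _; rewrite FP; congr F'; apply/funext => y.
  by case: ifP => _; rewrite ?(nmap_var phiP) ?(nmap_zero phiP).
rewrite /nmerge bigP; apply: eq_bigr => z _; rewrite FP; congr F'.
by apply/funext => z'.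
Qed.

End NormalForms.

Arguments Cst {V Z}.
Arguments Tr {V Z}.

(** * Finitely many bounded shapes *)

Section Shapes.
Variable (Z : finType) (M : nat).
Local Notation V := (fun=> unit : Type).

HB.instance Definition _ := gen_eqMixin (ctree V Z).
HB.instance Definition _ := gen_eqMixin (nform V Z).

Fixpoint tshapes (d : nat) : seq (ctree V Z) :=
  if d is d'.+1 then
    [seq Lf (tt : V true) z | z <- enum Z] ++
    [seq Br (tt : V true) s t | s <- tshapes d', t <- tshapes d']
  else [::].

(** The enumeration goes by height, which is at most the size. *)
Lemma mem_tshapes (t : ctree V Z) d : csize t <= d -> t \in tshapes d.
Proof.
elim: t d => [[] z|[] s IHs t IHt] [|d] //=; rewrite mem_cat => td.
  by rewrite map_f // mem_enum.
rewrite allpairs_f ?orbT //; first by apply: IHs; rewrite -ltnS; apply: leq_trans td;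
  rewrite ltnS leq_addr.
by apply: IHt; rewrite -ltnS; apply: leq_trans td; rewrite ltnS leq_addl.
Qed.

Definition nshapes : seq (nform V Z) := [seq Tr t | t <- tshapes M].
Definition shape_code := 'I_(size nshapes).+1.
Definition encode (m : nform V Z) : shape_code := inord (index m (Cst tt :: nshapes)).
Definition decode (c : shape_code) : nform V Z := nth (Cst tt) (Cst tt :: nshapes) c.

Lemma encodeK (m : nform V Z) : (if m is Tr t then csize t <= M else true) ->
  decode (encode m) = m.
Proof.
move=> mM; have min : m \in Cst tt :: nshapes.
  case: m mM => [[]|t] tM; rewrite inE ?eqxx //.
  by rewrite map_f ?orbT // mem_tshapes.
have im : index m (Cst tt :: nshapes) < size (Cst tt :: nshapes) by rewrite index_mem.
by rewrite /decode inordK ?nth_index.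
Qed.

End Shapes.

(** * Meaning of normal forms in the algebra *)

Section Values.
Variable A : choiceType.

Definition uhole : UCF A true := @ucf_pi A 1 [:: Hole] erefl.

Definition ucf_cops : cops A (UCF A) := @Cops A (UCF A) uempty uhole
  (fun a => uroot a uhole) (fun f g => uadd f g) (fun f C => uadd f C)
  (fun C f => usubst (i := true) (j := false) C f)
  (fun C D => usubst (i := true) (j := true) C D).

Definition hval (b : bool) (x : UCF A b) : hforest A := val x.

Lemma hval_inj b : injective (@hval b). Proof. exact: val_inj. Qed.

Lemma hholes_val b (x : UCF A b) : hholes (hval x) = b.
Proof. exact/eqP/(valP x). Qed.

Lemma hval_add01 f C : hval (cadd01 ucf_cops f C) = hadd (hval f) (hval C).
Proof. exact: erefl. Qed.

Fixpoint tsem Z (t : ctree (UCF A) Z) (rho : Z -> hforest A) : hforest A :=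
  match t with
  | Lf C z => hsubst (hval C) (rho z)
  | Br C s t => hsubst (hval C) (hadd (tsem s rho) (tsem t rho))
  end.

Definition sem Z (m : nform (UCF A) Z) (rho : Z -> hforest A) : hforest A :=
  match m with
  | Cst f => hval f
  | Tr t => tsem t rho
  end.

Variables (Z : Type) (rho : Z -> hforest A).

Lemma sem_zero : sem (nzero ucf_cops Z) rho = hzero.
Proof. by []. Qed.

Lemma sem_var z : sem (nvar ucf_cops z) rho = rho z.
Proof. exact: hsubst_hole. Qed.

Lemma sem_app C (m : nform (UCF A) Z) :
  sem (napp ucf_cops C m) rho = hsubst (hval C) (sem m rho).
Proof.
case: m => [f|[D z|D s t]] /=; [exact: erefl | exact: hsubstA | exact: hsubstA].
Qed.

Lemma tsem_add f (t : ctree (UCF A) Z) :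
  tsem (tadd ucf_cops f t) rho = hadd (hval f) (tsem t rho).
Proof.
by case: t => [D z|D s t]; rewrite /tadd /tsem -/tsem hval_add01 hsubstDl hsubst_id
  ?hholes_val.
Qed.

Lemma sem_add (m m' : nform (UCF A) Z) :
  sem (nadd ucf_cops m m') rho = hadd (sem m rho) (sem m' rho).
Proof.
case: m m' => [f|s] [g|t] //=; rewrite ?tsem_add //; first exact: haddC.
exact: hsubst_hole.
Qed.

Lemma sem_root a (m : nform (UCF A) Z) :
  sem (napp ucf_cops (croot ucf_cops a) m) rho = hnode a (sem m rho).
Proof.
by rewrite sem_app [LHS](hsubst_node a (hhole : hforest A)) hsubst_hole.
Qed.

Lemma hholes_tsem (t : ctree (UCF A) Z) : (forall z, hholes (rho z) = 1) ->
  hholes (tsem t rho) = tleaves t.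
Proof.
move=> rho1; elim: t => [C z|C s IHs t IHt] /=.
  by rewrite hholes_subst hholes_val rho1.
by rewrite hholes_subst hholes_val hholesD IHs IHt mul1n.
Qed.

End Values.

Lemma sem_sub (A : choiceType) Z Z' (sigma : Z -> nform (UCF A) Z') m rho :
  sem (nsub (ucf_cops A) sigma m) rho = sem m (fun z => sem (sigma z) rho).
Proof.
case: m => //=; elim=> [C z|C s IHs t IHt] /=; first exact: sem_app.
by rewrite sem_app sem_add IHs IHt.
Qed.

Lemma sem_ground (A : choiceType) Z (m : nform (UCF A) Z) :
  hval (nground (ucf_cops A) m) = sem m (fun=> hzero).
Proof.
case: m => //=; elim=> [C z|C s IHs t IHt] //=.
by rewrite -IHs -IHt.
Qed.

Lemma sem_merge (A : choiceType) (Z K : finType) (link : rel Z)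
    (opz att : pred Z) (ncol : Z -> K) F F' rho k :
  (forall z sigma, sem (F z sigma) rho = F' z (fun y => sem (sigma y) rho)) ->
  sem (nmerge (ucf_cops A) link opz att ncol F k) rho =
  \hsum_(z | (ncol z == k) && ~~ att z) F' z (solve link opz ncol rho F' #|Z|).
Proof.
move=> FP; pose sem' (m : nform (UCF A) K) := sem m rho.
have bigP := big_morph sem' (sem_add rho) (sem_zero rho).
have solveP d z : sem (nsolve (ucf_cops A) link opz ncol F d z) rho =
    solve link opz ncol rho F' d z.
  elim: d z => [|d IHd] z //=; rewrite sem_add; congr hadd.
    rewrite [LHS]bigP; apply: eq_bigr => z' _; rewrite /sem' FP; congr F'.
    by apply/funext => y.
  by case: ifP => _; rewrite ?sem_var.
rewrite [LHS]bigP; apply: eq_bigr => z _; rewrite /sem' FP; congr F'.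
by apply/funext => y.
Qed.

Section Terms.
Variables (A : choiceType) (X : Type) (vs : X -> bool).
Local Notation T := (@term (UCF A) X vs).

Definition term_add00 (f g : T false) : T false :=
  @App (UCF A) X vs (Add00 A) (fun k => if k == ord0 then f else g).

Definition term_add01 (f : T false) (C : T true) : T true :=
  @App (UCF A) X vs (Add01 A)
    (fun k => if k == ord0 as b return T (~~ b) then f else C).

Definition term_subst (i j : bool) (C : T i) (D : T j) : T (i && j) :=
  @App (UCF A) X vs (Subst A i j)
    (fun k => if k == ord0 as b return T (if b then i else j) then C else D).

Definition term_cops : cops A T := @Cops A T
  (@Const (UCF A) X vs _ (czero (ucf_cops A))) (@Const (UCF A) X vs _ (chole (ucf_cops
    A)))
  (fun a => @Const (UCF A) X vs _ (croot (ucf_cops A) a))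
  term_add00 term_add01 (@term_subst true false) (@term_subst true true).

(** Hence a computation carried out on terms produces register updates that evaluate to the same
    computation on values. *)
Lemma chom_eval (r : forall x, UCF A (vs x)) :
  chom term_cops (ucf_cops A) (fun b (e : T b) => eval r e).
Proof. by []. Qed.

End Terms.

(** * The register automaton *)

Section RankCast.
Variables (J : finType) (s : J -> bool).

Definition rank_sort (r : 'I_#|J|) : bool := s (enum_val r).

(** The automaton numbers its registers while the construction indexes them by cells; the sorts
    agree only up to [enum_rankK]. *)
Definition rank_cast (T : bool -> Type) (j : J) (x : T (rank_sort (enum_rank j))) :
  T (s j) := ecast i (T (s i)) (enum_rankK j) x.

Lemma rank_castE (T : bool -> Type) (g : forall j, T (s j)) (j : J) :
  rank_cast (T := T) (g (enum_val (enum_rank j))) = g j.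
Proof.
rewrite /rank_cast; move: (enum_rankK j); rewrite /rank_sort.
by move: (enum_val (enum_rank j)) => x e; case: _ / e.
Qed.

Lemma rank_cast_morph (T U : bool -> Type) (phi : forall b, T b -> U b) (j : J) x :
  phi _ (rank_cast (T := T) (j := j) x) = rank_cast (phi _ x).
Proof.
move: x; rewrite /rank_cast; move: (enum_rankK j); rewrite /rank_sort.
by move: (enum_val (enum_rank j)) => y e; case: _ / e.
Qed.

End RankCast.

Section Construction.
Variables (A B : finType) (n : nat) (D : dta A (bool * bool)).
Variables (dom : dstate D -> bool) (lb : 'I_n -> dstate D -> option B).
Variable ch : 'I_n -> 'I_n -> dstate D -> bool.
Local Notation Q := (dstate D).
Implicit Types (a : A) (t : btree A).

(* The colour of an output node [(u, i)] of a subtree: the states reached when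
   [u] carries the parent mark, resp. the child mark, and the copy [i]. *)
Definition colour : finType := (Q * Q * 'I_n)%type.

Definition colour_of t (u : bstruct t * 'I_n) : colour :=
  (drun D (mark2 (Some u.1) None), drun D (mark2 None (Some u.1)), u.2).

Definition info : finType := (Q * {set colour})%type.

Definition info_of t : info :=
  (drun D (mark2 (t := t) None None), [set colour_of u | u : bstruct t * 'I_n]).

(* An output node below a binary node comes from the left subtree, the right
   subtree, or is a copy of the binary node itself. *)
Definition place : finType := (colour + colour + 'I_n)%type.

Definition copy_of (z : place) : 'I_n :=
  match z with inl (inl k) => k.2 | inl (inr k) => k.2 | inr i => i end.

(** Each new copy is a block of its own, so an edge between two copies of the binary node is a link
    like any other. *)
Definition block_of (z : place) : bool + 'I_n :=
  match z with inl (inl _) => inl true | inl (inr _) => inl false | inr i => inr i end.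

Definition is_new (z : option place) : bool := if z is Some (inr _) then true else
  false.

Definition left_colour (z : option place) : option colour :=
  if z is Some (inl (inl k)) then Some k else None.

Definition right_colour (z : option place) : option colour :=
  if z is Some (inl (inr k)) then Some k else None.

(** If both marks fall into one subtree, the second is ignored; [link] relies on the result only for
    places in distinct blocks, where this cannot happen. *)
Definition marked_state (q : Q) (x y : option colour) : Q :=
  match x, y with
  | Some k, _ => k.1.1
  | None, Some k => k.1.2
  | None, None => q
  end.

Section Step.
Variables (a : A) (j1 j2 : info).

Definition step_state (x y : option place) : Q :=
  dstep a (is_new x, is_new y)
    (marked_state j1.1 (left_colour x) (left_colour y))
    (marked_state j2.1 (right_colour x) (right_colour y)).

Definition new_colour (z : place) : colour :=
  (step_state (Some z) None, step_state None (Some z), copy_of z).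

Definition actual (z : place) : bool :=
  match z with
  | inl (inl k) => k \in j1.2
  | inl (inr k) => k \in j2.2
  | inr _ => true
  end.

Definition info_step : info :=
  (step_state None None, [set new_colour z | z : place & actual z]).

(* What a subtree needs to know about the rest of the tree: the state of the
   whole tree as a function of its own state, and the colours of its output
   nodes that have a child elsewhere. *)
Variable c : {ffun Q -> Q} * {set colour}.

Definition link (z z' : place) : bool :=
  (block_of z != block_of z') &&
  ch (copy_of z) (copy_of z') (c.1 (step_state (Some z) (Some z'))).

Definition port (z : place) : bool := new_colour z \in c.2.

(** [link] may hold at a place that no output node occupies; [actual] excludes such phantom parents,
    which would hide genuine roots. *)
Definition has_parent (z : place) : bool := [exists z', actual z' && link z' z].

Definition has_child (z : place) : bool := [exists z', actual z' && link z z'].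

Definition left_context : {ffun Q -> Q} * {set colour} :=
  ([ffun q => c.1 (dstep a (false, false) q j2.1)],
   [set k | port (inl (inl k)) || has_child (inl (inl k))]).

Definition right_context : {ffun Q -> Q} * {set colour} :=
  ([ffun q => c.1 (dstep a (false, false) j1.1 q)],
   [set k | port (inl (inr k)) || has_child (inl (inr k))]).

Variables (V : bool -> Type) (O : cops B V) (G1 G2 : colour -> nform V colour).

Definition place_value (z : place) (sigma : place -> nform V colour) : nform V colour :=
  match z with
  | inl (inl k) => nsub O (fun k => sigma (inl (inl k))) (G1 k)
  | inl (inr k) => nsub O (fun k => sigma (inl (inr k))) (G2 k)
  | inr i => if lb i (c.1 (step_state (Some z) None)) is Some b
             then napp O (croot O b) (sigma z) else nzero O colour
  end.

Definition value_step (k : colour) : nform V colour :=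
  clip O (#|colour|).*2 (nmerge O link port has_parent new_colour place_value k).
End Step.

Definition context : finType := ({ffun Q -> Q} * {set colour})%type.

Lemma nmap_value_step V W (O : cops B V) (O' : cops B W) phi a j1 j2 c
    (G1 G2 : colour -> nform V colour) k : chom O O' phi ->
  nmap phi (value_step a j1 j2 c O G1 G2 k) =
  value_step a j1 j2 c O' (fun k => nmap phi (G1 k)) (fun k => nmap phi (G2 k)) k.
Proof.
move=> phiP; rewrite (nmap_clip phiP); congr clip.
apply: nmap_merge => // -[[z|z]|i] sigma /=; rewrite ?(nmap_sub phiP) //.
case: (lb _ _) => [b|]; last exact: nmap_zero.
by rewrite (nmap_app phiP) (chom_root phiP).
Qed.

(** The intended register contents. Contexts are passed downwards here, whereas the automaton
    guesses them upwards. *)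
Fixpoint value t (c : context) : colour -> nform (UCF B) colour :=
  if t is BNode a l r then
    value_step a (info_of l) (info_of r) c (ucf_cops B)
      (value l (left_context a (info_of l) (info_of r) c))
      (value r (right_context a (info_of l) (info_of r) c))
  else fun=> nzero (ucf_cops B) colour.

Lemma value_small t c k :
  if value t c k is Tr s then csize s <= (#|colour|).*2 else true.
Proof.
by case: t => [|a l r] //=; rewrite /value_step /clip; case: nmerge => // s; case: ifP.
Qed.

Fixpoint btree_of (t : rtree (bin_sig A)) : btree A :=
  let: RNode a x := t in
  match a return ('I_(rank (a : bin_sig A)) -> btree A) -> btree A with
  | None => fun=> BLeaf
  | Some a => fun f => BNode a (f ord0) (f ord_max)
  end (fun i => btree_of (x i)).

Local Notation M := (#|colour|).*2.
Definition cell : finType := (colour * 'I_M.+1 * bool)%type.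
Local Notation shape_state := {ffun colour -> shape_code colour M}.
Definition astate : finType := (info * context * shape_state)%type.


Definition cell_sort (j : cell) : bool := j.2.
Local Notation R := #|{: cell}|.

Definition cells (G : colour -> nform (UCF B) colour) (r : 'I_R) :
    UCF B (rank_sort cell_sort r) :=
  register (ucf_cops B) (G (enum_val r).1.1) (enum_val r).1.2 (enum_val r).2.

Definition save (V : bool -> Type) (G : colour -> nform V colour) : shape_state :=
  [ffun k => encode M (nshape (G k))].

Definition load (T : bool -> Type) (sh : shape_state)
    (var : forall r : 'I_R, T (rank_sort cell_sort r)) (k : colour) :
    nform T colour :=
  fill (V := T) (decode (sh k)) (fun m b =>
    rank_cast (s := cell_sort) (T := T) (var (enum_rank ((k, inord m, b) : cell)))).

Lemma nmap_load T U (phi : forall b, T b -> U b) sh var k :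
  nmap phi (load (T := T) sh var k) = load (T := U) sh (fun r => phi _ (var r)) k.
Proof.
rewrite nmap_fill; congr fill; apply/funext => m;
  apply: functional_extensionality_dep => b.
exact: (rank_cast_morph (s := cell_sort) phi (j := (k, inord m, b))).
Qed.

Definition small (V : bool -> Type) (G : colour -> nform V colour) : Prop :=
  forall k, if G k is Tr t then csize t <= M else true.

Lemma decode_save V (G : colour -> nform V colour) k : small G ->
  decode (save G k) = nshape (G k).
Proof.
move=> /(_ k) sG; rewrite /save ffunE encodeK //.
by case: (G k) sG => //= t; rewrite csize_map.
Qed.

Lemma load_cells (G : colour -> nform (UCF B) colour) : small G ->
  load (T := UCF B) (save G) (cells G) = G.
Proof.
move=> sG; apply/funext => k; rewrite /load decode_save //.
apply: (fill_register (O := ucf_cops B) (M := M)); first exact: sG.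
move=> m b mM; rewrite (rank_castE (s := cell_sort) (T := UCF B)
  (fun j => register (ucf_cops B) (G j.1.1) j.1.2 j.2)) /= inordK //.
Qed.

Definition child_sort (v : 'I_2 * 'I_R) : bool := rank_sort cell_sort v.2.

Definition child_vars (k : 'I_2) (r : 'I_R) :
    @term (UCF B) _ child_sort (rank_sort cell_sort r) :=
  @Var (UCF B) _ child_sort (k, r).

Local Notation aregsort := (fun (_ : astate) (r : 'I_R) => rank_sort cell_sort r).

Definition leaf_rule (c : context) : rule (R := UCF B) aregsort 0 :=
  @Rule (UCF B) R astate aregsort 0
    (fun k : 'I_0 => match notF (ltn_ord k) return astate with end)
    (info_of BLeaf, c, save (value BLeaf c))
    (fun r => @Const (UCF B) _ _ _ (cells (value BLeaf c) r)).

(** The guess [c] at the node prescribes the guesses that its children must have made. [value_step]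
    is run over [unit_cops] for the new shapes and over [term_cops] for the updates. *)
Definition node_rule (a : A) (rho : info * shape_state * (info * shape_state) *
  context) :
    rule (R := UCF B) aregsort 2 :=
  let: ((j1, sh1), (j2, sh2), c) := rho in
  @Rule (UCF B) R astate aregsort 2
    (fun k => if k == ord0 then (j1, left_context a j1 j2 c, sh1)
              else (j2, right_context a j1 j2 c, sh2))
    (info_step a j1 j2, c,
     save (value_step a j1 j2 c (unit_cops B) (fun k => decode (sh1 k)) (fun k =>
       decode (sh2 k))))
    (fun r => register (term_cops B child_sort)
       (value_step a j1 j2 c (term_cops B child_sort)
          (load (T := @term (UCF B) _ child_sort) sh1 (child_vars ord0))
          (load (T := @term (UCF B) _ child_sort) sh2 (child_vars ord_max)) (enum_val
            r).1.1)
       (enum_val r).1.2 (enum_val r).2).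

(** Nothing surrounds the whole tree. Accepting this context only validates, through the rules,
    every guess below. *)
Definition top_context : context := ([ffun q => q], finset.set0).

Definition final_term (sh : shape_state) : @term (UCF B) 'I_R (rank_sort cell_sort)
  false :=
  let O := term_cops B (rank_sort cell_sort) in
  \big[cadd00 O/czero O]_(k : colour)
    nground O (load (T := @term (UCF B) 'I_R (rank_sort cell_sort)) sh
      (@Var (UCF B) 'I_R (rank_sort cell_sort)) k).

Definition transducer : reg_automaton (bin_sig A) (UCF B) :=
  @RegAutomaton (bin_sig A) (UCF B) R astate aregsort
    (fun a : option A => if a is Some _ then
       (info * shape_state * (info * shape_state) * context)%type : finType else
         context)
    (fun a : option A => match a return
        (if a is Some _ then
           (info * shape_state * (info * shape_state) * context)%type : finType else
             context) ->
        rule (R := UCF B) aregsort (if a is Some _ then 2 else 0) with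
      | Some a => node_rule a | None => leaf_rule end)
    (fun q : astate => if (q.1.2 == top_context) && dom q.1.1.1
       then Some (existT _ false (final_term q.2)) else None).

End Construction.

(** * Runs compute the recursive value *)

Section Correctness.
Variables (A B : finType) (n : nat) (D : dta A (bool * bool)).
Variables (dom : dstate D -> bool) (lb : 'I_n -> dstate D -> option B).
Variable ch : 'I_n -> 'I_n -> dstate D -> bool.
Implicit Types (a : A) (t : btree A).

Section Places.
Variables (a : A) (l r : btree A).
Local Notation S := (bstruct (BNode a l r)).

Definition place_of (u : S * 'I_n) : place n D :=
  match u.1 with
  | inl None => inr u.2
  | inl (Some v) => inl (inl (colour_of D (v, u.2)))
  | inr v => inl (inr (colour_of D (v, u.2)))
  end.

(** Colours record states under a single mark, which suffices when the marks lie in different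
    blocks: each subtree then carries at most one. *)
Lemma step_stateE (x y : option (S * 'I_n)) :
  (if x is Some u then if y is Some v then
     block_of (place_of u) != block_of (place_of v) else true else true) ->
  drun D (mark2 (omap fst x) (omap fst y)) =
  step_state a (info_of n D l) (info_of n D r) (omap place_of x) (omap place_of y).
Proof.
by case: x => [[[[u|]|u] i]|]; case: y => [[[[v|]|v] j]|].
Qed.

Lemma colour_ofE (u : S * 'I_n) :
  colour_of D u = new_colour a (info_of n D l) (info_of n D r) (place_of u).
Proof.
rewrite /colour_of /new_colour -(step_stateE (x := Some u) (y := None)) //.
rewrite -(step_stateE (x := None) (y := Some u)) //.
by case: u => -[[u|]|u] i.
Qed.

Lemma actualP z : reflect (exists u : S * 'I_n, z = place_of u)
  (actual (info_of n D l) (info_of n D r) z).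
Proof.
apply: (iffP idP) => [|[[[[u|]|u] i] ->]] //=; last 2 first.
- exact: imset_f.
- exact: imset_f.
case: z => [[k|k]|i] /=.
- by case/imsetP=> [[u i] _ ->]; exists (pleft a r u, i).
- by case/imsetP=> [[u i] _ ->]; exists (pright a l u, i).
- by exists (proot a l r, i).
Qed.

Lemma info_ofE : info_of n D (BNode a l r) = info_step a (info_of n D l) (info_of n D
  r).
Proof.
rewrite /info_step -(step_stateE (x := None) (y := None)) //; congr pair.
apply/setP=> k; apply/imsetP/imsetP => [[u _ ->]|[z]].
  by exists (place_of u); rewrite ?colour_ofE // inE; apply/actualP; exists u.
by rewrite inE => /actualP[u ->] ->; exists u; rewrite ?colour_ofE.
Qed.

End Places.

Local Notation transducer := (transducer dom lb ch).
Local Notation value := (value lb ch).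

Lemma nshape_id V Z (m : nform V Z) : nshape (nshape m) = nshape m.
Proof.
by case: m => //= t; congr Tr; elim: t => //= C s -> t ->.
Qed.

Lemma save_nshape V (G : colour n D -> nform V (colour n D)) :
  save (fun k => nshape (G k)) = save G.
Proof. by apply/ffunP => k; rewrite !ffunE nshape_id. Qed.

Lemma value_is_small t c : small (value t c).
Proof. by move=> k; exact: value_small. Qed.

Lemma save_value_step a l r c :
  let j1 := info_of n D l in let j2 := info_of n D r in
  let G1 := value l (left_context ch a j1 j2 c) in
  let G2 := value r (right_context ch a j1 j2 c) in
  save (value_step lb ch a j1 j2 c (unit_cops B)
     (fun k => decode (save G1 k)) (fun k => decode (save G2 k))) =
  save (value (BNode a l r) c).
Proof.
move=> j1 j2 G1 G2; rewrite -[RHS]save_nshape; congr save; apply/funext => k.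
rewrite [RHS](nmap_value_step _ _ _ _ _ _ _ _ _ (chom_unit (ucf_cops B))).
congr value_step; apply/funext => k'; apply: decode_save; exact: value_is_small.
Qed.

Lemma eval_value_step a l r c k (x : 'I_2 -> forall i, UCF B (rank_sort _ i)) :
  let j1 := info_of n D l in let j2 := info_of n D r in
  let G1 := value l (left_context ch a j1 j2 c) in
  let G2 := value r (right_context ch a j1 j2 c) in
  (forall i, x ord0 i = cells G1 i) -> (forall i, x ord_max i = cells G2 i) ->
  nmap (fun b e => eval (fun v => x v.1 v.2) e)
    (value_step lb ch a j1 j2 c (term_cops B (child_sort (n := n) (D := D)))
      (load (T := @term (UCF B) _ _) (save G1) (@child_vars _ _ _ _ ord0))
      (load (T := @term (UCF B) _ _) (save G2) (@child_vars _ _ _ _ ord_max)) k) =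
  value (BNode a l r) c k.
Proof.
move=> j1 j2 G1 G2 x1 x2.
rewrite (nmap_value_step _ _ _ _ _ _ _ _ _ (chom_eval _)) /=.
congr value_step.
  rewrite -(load_cells (value_is_small l (left_context ch a j1 j2 c))).
  apply/funext => k'; rewrite nmap_load; congr load.
  apply: functional_extensionality_dep => i; exact: x1.
rewrite -(load_cells (value_is_small r (right_context ch a j1 j2 c))).
apply/funext => k'; rewrite nmap_load; congr load.
apply: functional_extensionality_dep => i; exact: x2.
Qed.

(** The context in the state determines the rest of the state and the registers; with [value_run],
    each context has exactly one outcome. *)
Lemma run_value rt (q : state transducer) x : run rt (q := q) x -> exists c,
  q = (info_of n D (btree_of rt), c, save (value (btree_of rt) c)) /\
  forall r, x r = cells (value (btree_of rt) c) r.
Proof.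
elim=> {rt q x} -[a|] rho c x _ IH; last by exists rho.
case: rho x IH => -[[j1 sh1] [j2 sh2]] c0 x IH /=.
have [c1 [[j1E c1E sh1E] x1]] := IH ord0; have [c2 [[j2E c2E sh2E] x2]] := IH ord_max.
move: {IH} c1E c2E => /esym c1E /esym c2E; subst c1 c2 j1 j2 sh1 sh2.
exists c0; split; first by rewrite save_value_step -info_ofE.
move=> r; rewrite (register_map (chom_eval (fun v : 'I_2 * 'I_#|{: cell n D}| => x v.1
  v.2))).
by rewrite (eval_value_step _ x1 x2).
Qed.

Lemma run_congr rt (q q' : state transducer) x x' :
  run rt (q := q) x -> q = q' ->
  (forall r, x r = x' r :> UCF B (rank_sort (cell_sort (n := n) (D := D)) r)) ->
  run rt (q := q') x'.
Proof.
move=> qx qq'; subst q' => xx'; rewrite (_ : x' = x) //.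
by apply: functional_extensionality_dep => r; rewrite xx'.
Qed.

(** Every guess is realised: leaves accept any context, and the induction covers the contexts that
    the rule demands of the children. *)
Lemma value_run rt c : run rt
  (q := (info_of n D (btree_of rt), c, save (value (btree_of rt) c)) : state transducer)
  (fun r => cells (value (btree_of rt) c) r).
Proof.
elim: rt c => -[a|] f IH c; last first.
  apply: run_congr (Run (M := transducer) (a := None) (rho := c) (c := f)
    (x := fun i => match notF (ltn_ord i) with end) _) _ _ => //.
  by case.
pose l := btree_of (f ord0); pose r := btree_of (f ord_max).
pose j1 := info_of n D l; pose j2 := info_of n D r.
pose G1 := value l (left_context ch a j1 j2 c).
pose G2 := value r (right_context ch a j1 j2 c).
pose rho : rule_idx transducer (Some a) := ((j1, save G1), (j2, save G2), c).
pose x (i : 'I_2) k := if i == ord0 then cells G1 k else cells G2 k.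
apply: run_congr (Run (M := transducer) (a := Some a) (rho := rho) (c := f) (x := x)
  _) _ _.
- case=> -[|[|//]] i2.
    rewrite (_ : Ordinal i2 = ord0); last exact: val_inj.
    exact: IH.
  rewrite (_ : Ordinal i2 = ord_max); last exact: val_inj.
  exact: IH.
- by rewrite /= save_value_step -info_ofE.
- move=> k; rewrite /= (register_map (chom_eval (fun v : 'I_2 * 'I_#|{: cell n D}| =>
  x v.1 v.2))).
  by rewrite (@eval_value_step a l r c _ x).
Qed.

Definition result t : UCF B false :=
  \big[cadd00 (ucf_cops B)/czero (ucf_cops B)]_(k : colour n D)
    nground (ucf_cops B) (value t (top_context n D) k).

Lemma hval_result t :
  hval (result t) = \hsum_(k | true) sem (value t (top_context n D) k) (fun=> hzero).
Proof.
rewrite /result (big_morph (@hval B false) (id1 := hzero) (op1 := @hadd B)) //.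
by apply: eq_bigr => k _; exact: sem_ground.
Qed.

Lemma eval_final t : eval (cells (value t (top_context n D)))
  (final_term B (save (value t (top_context n D)))) = result t.
Proof.
have evP := chom_eval (cells (value t (top_context n D))).
rewrite /final_term (big_morph _ (chom_add00 evP) (chom_zero evP)).
apply: eq_bigr => k _; rewrite (nmap_ground evP) nmap_load.
by rewrite (load_cells (value_is_small t (top_context n D))).
Qed.

Lemma outputs_transducer rt : let t := btree_of rt in
  outputs transducer rt =
    (if dom (info_of n D t).1 then [set existT (UCF B) false (result t)] else
      set0)%classic.
Proof.
move=> t; apply/seteqP; split=> y.
  case=> q [x [f [/run_value[c [qE xE]] fq ->]]]; subst q; move: fq => /=.
  case: ifP => //= /andP[/eqP cE dt] [<-]; rewrite dt /=; subst c.
  have xE' := functional_extensionality_dep xE; rewrite {}xE' {x xE}.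
  by rewrite -/t -eval_final.
case: ifP => // dt ->; exists (info_of n D t, top_context n D, save (value t
  (top_context n D))).
exists (cells (value t (top_context n D))).
exists (existT _ false (final_term B (save (value t (top_context n D))))).
split; first exact: value_run.
  by rewrite /= eqxx dt.
by rewrite /= eval_final.
Qed.

End Correctness.

(** * Cutting the output forest along a subtree *)

Section Occurrences.
Variables (A B : finType) (n : nat) (D : dta A (bool * bool)).
Variables (lb : 'I_n -> dstate D -> option B) (ch : 'I_n -> 'I_n -> dstate D -> bool).
Variable t0 : btree A.
Implicit Types (a : A) (s l r : btree A).

Local Notation context := (context n D).
Local Notation onode s := (bstruct s * 'I_n)%type.
Local Notation info := (info_of n D).

Definition edge (x y : onode t0) : bool :=
  ch x.2 y.2 (drun D (mark2 (Some x.1) (Some y.1))).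

Definition olabel (x : onode t0) : option B :=
  lb x.2 (drun D (mark2 (Some x.1) None)).

(** Follows the contexts that [value] passes down from the top, together with the embedding of the
    positions of the subtree. *)
Inductive occurs : forall s, (bstruct s -> bstruct t0) -> context -> Prop :=
| occurs_top : @occurs t0 id (top_context n D)
| occurs_left a l r (e : bstruct (BNode a l r) -> bstruct t0) c : occurs e c ->
    @occurs l (e \o pleft a r) (left_context ch a (info l) (info r) c)
| occurs_right a l r (e : bstruct (BNode a l r) -> bstruct t0) c : occurs e c ->
    @occurs r (e \o @pright A a l r) (right_context ch a (info l) (info r) c).

Definition embed s (e : bstruct s -> bstruct t0) (u : onode s) : onode t0 :=
  (e u.1, u.2).

Definition outside s (e : bstruct s -> bstruct t0) (y : bstruct t0) : Prop :=
  forall u, e u != y.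

Lemma occurs_inj s (e : bstruct s -> bstruct t0) c : occurs e c -> injective e.
Proof.
elim=> {s e c} [|a l r e c _ e_inj|a l r e c _ e_inj] //.
- exact: inj_comp e_inj (@pleft_inj _ _ _ _).
- exact: inj_comp e_inj (@pright_inj _ _ _ _).
Qed.

(** A subtree influences the run on the whole tree only through the state at its root. *)
Lemma occurs_drun s (e : bstruct s -> bstruct t0) c : occurs e c ->
  forall w w' : bstruct t0 -> bool * bool,
  (forall y, outside e y -> w y = w' y) -> drun D (w \o e) = drun D (w' \o e) ->
  drun D w = drun D w'.
Proof.
elim=> {s e c} [|a l r e c oe IH|a l r e c oe IH] w w' ww' dww' //.
all: have e_inj := occurs_inj oe; apply: IH => [y ye|/=]; first by apply: ww' => u;
  exact: ye.
- congr (dstep a _ _ _) => //; first by apply: ww' => u /=; rewrite inj_eq.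
  by congr drun; apply/funext => v; apply: ww' => u /=; rewrite inj_eq.
- congr (dstep a _ _ _) => //; first by apply: ww' => u /=; rewrite inj_eq.
  by congr drun; apply/funext => v; apply: ww' => u /=; rewrite inj_eq.
Qed.

Lemma occurs_state s (e : bstruct s -> bstruct t0) c : occurs e c ->
  forall w : bstruct t0 -> bool * bool,
  (forall y, outside e y -> w y = (false, false)) -> drun D w = c.1 (drun D (w \o e)).
Proof.
elim=> {s e c} [|a l r e c oe IH|a l r e c oe IH] w w0; first by rewrite ffunE.
all: have e_inj := occurs_inj oe.
all: rewrite IH; last by move=> y ye; apply: w0 => u; exact: ye.
all: rewrite ffunE; congr (c.1 _); congr (dstep a _ _ _).
- by apply: w0 => u /=; rewrite inj_eq.
- by congr drun; apply/funext => v; apply: w0 => u /=; rewrite inj_eq.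
- by apply: w0 => u /=; rewrite inj_eq.
- by congr drun; apply/funext => v; apply: w0 => u /=; rewrite inj_eq.
Qed.

Section Occurrence.
Variables (s : btree A) (e : bstruct s -> bstruct t0) (c : context).
Hypothesis oe : occurs e c.
Let e_inj := occurs_inj oe.

Lemma embed_inj : injective (embed e).
Proof. by move=> [u i] [v j] [/e_inj -> ->]. Qed.

Lemma edge_embed (u v : onode s) : edge (embed e u) (embed e v) =
  ch u.2 v.2 (c.1 (drun D (mark2 (Some u.1) (Some v.1)))).
Proof.
rewrite /edge (occurs_state oe) => [|y ye]; last first.
  by congr pair; apply/negbTE; apply: ye.
by congr (ch _ _ _); congr (c.1 _); congr drun; apply/funext => y;
  congr pair; rewrite /= (inj_eq Some_inj) inj_eq.
Qed.

Lemma olabel_embed (u : onode s) : olabel (embed e u) =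
  lb u.2 (c.1 (drun D (mark2 (Some u.1) None))).
Proof.
rewrite /olabel (occurs_state oe) => [|y ye]; last first.
  by congr pair; apply/negbTE; apply: ye.
by congr (lb _ _); congr (c.1 _); congr drun; apply/funext => y;
  congr pair; rewrite /= (inj_eq Some_inj) inj_eq.
Qed.

(** The subtree carries the parent mark alone, so it acts through the first component of the
    colour. *)
Lemma edge_outside (u v : onode s) y : outside e y.1 ->
  colour_of D u = colour_of D v -> edge (embed e u) y = edge (embed e v) y.
Proof.
move=> ye [uv _ ij]; rewrite /edge /= ij; congr (ch _ _ _).
apply: (occurs_drun oe) => [z ze|].
  by congr pair; rewrite !(inj_eq Some_inj) !(negbTE (ze _)).
have markE (x : onode s) : mark2 (Some (embed e x).1) (Some y.1) \o e =1 mark2 (Some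
  x.1) None.
  move=> z; congr pair; rewrite /= (inj_eq Some_inj); first by rewrite inj_eq.
  by rewrite eq_sym; apply/negbTE; apply: ye.
by rewrite (funext (markE u)) (funext (markE v)).
Qed.
End Occurrence.

Section Children.
Variables (a : A) (l r : btree A) (e : bstruct (BNode a l r) -> bstruct t0).
Variable c : context.
Hypothesis oe : occurs e c.

Lemma copy_place (u : onode (BNode a l r)) : copy_of (place_of D u) = u.2.
Proof. by case: u => -[[u|]|u] i. Qed.

Lemma link_place (u v : onode (BNode a l r)) :
  link ch a (info l) (info r) c (place_of D u) (place_of D v) =
  edge (embed e u) (embed e v) && (block_of (place_of D u) != block_of (place_of D v)).
Proof.
rewrite /link andbC; case: (boolP (_ != _)) => uv; rewrite ?andbF ?andbT //.
by rewrite (edge_embed oe) !copy_place -(step_stateE (x := Some u) (y := Some v)).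
Qed.

Lemma has_parentP (u : onode (BNode a l r)) :
  reflect (exists2 v, edge (embed e v) (embed e u) &
             block_of (place_of D v) != block_of (place_of D u))
    (has_parent ch a (info l) (info r) c (place_of D u)).
Proof.
apply: (iffP idP) => [/existsP[z /andP[/(actualP a l r)[v ->]]]|[v vu uv]].
  by rewrite link_place => /andP[vu uv]; exists v.
by apply/existsP; exists (place_of D v); rewrite link_place vu uv !andbT;
  apply/(actualP a l r); exists v.
Qed.

Lemma has_childP (u : onode (BNode a l r)) :
  reflect (exists2 v, edge (embed e u) (embed e v) &
             block_of (place_of D u) != block_of (place_of D v))
    (has_child ch a (info l) (info r) c (place_of D u)).
Proof.
apply: (iffP idP) => [/existsP[z /andP[/(actualP a l r)[v ->]]]|[v vu uv]].
  by rewrite link_place => /andP[vu uv]; exists v.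
by apply/existsP; exists (place_of D v); rewrite link_place vu uv !andbT;
  apply/(actualP a l r); exists v.
Qed.

Lemma port_place (u : onode (BNode a l r)) :
  port a (info l) (info r) c (place_of D u) = (colour_of D u \in c.2).
Proof. by rewrite /port -colour_ofE. Qed.

Definition oleft (u : onode l) : onode (BNode a l r) := (pleft a r u.1, u.2).
Definition oright (u : onode r) : onode (BNode a l r) := (pright a l u.1, u.2).

End Children.

(** A node outside a child subtree lies either outside the parent subtree, where induction applies,
    or in another block, where [has_child] does. *)
Lemma occurs_port s (e : bstruct s -> bstruct t0) c : occurs e c ->
  forall u : onode s, colour_of D u \in c.2 <->
    exists2 y, outside e y.1 & edge (embed e u) y.
Proof.
elim=> {s e c} [|a l r e c oe IH|a l r e c oe IH] u.
- rewrite inE; split=> // -[y ye _].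
  by have := ye y.1; rewrite eqxx.
- have e_inj := occurs_inj oe.
  rewrite inE -[inl (inl _)](_ : place_of D (oleft a r u) = _); last by case: u.
  rewrite port_place; split.
    case/orP=> [/IH[y ye uy]|/(has_childP oe)[v uv bv]].
      by exists y => // v; exact: ye.
    exists (embed e v) => // w /=; rewrite inj_eq //.
    by case: v bv {uv} => -[[v|]|v] i.
  case=> y ye uy; case: (pselect (outside e y.1)) => [oy|].
    by apply/orP; left; apply/IH; exists y.
  case/existsNP=> v /negP/negbNE/eqP vy; apply/orP; right; apply/(has_childP oe).
  exists (v, y.2); first by rewrite /embed /= vy -surjective_pairing.
  by case: v vy => [[v|]|v] //= vy; have := ye v; rewrite /= vy eqxx.
- have e_inj := occurs_inj oe.
  rewrite inE -[inl (inr _)](_ : place_of D (oright a l u) = _); last by case: u.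
  rewrite port_place; split.
    case/orP=> [/IH[y ye uy]|/(has_childP oe)[v uv bv]].
      by exists y => // v; exact: ye.
    exists (embed e v) => // w /=; rewrite inj_eq //.
    by case: v bv {uv} => -[[v|]|v] i.
  case=> y ye uy; case: (pselect (outside e y.1)) => [oy|].
    by apply/orP; left; apply/IH; exists y.
  case/existsNP=> v /negP/negbNE/eqP vy; apply/orP; right; apply/(has_childP oe).
  exists (v, y.2); first by rewrite /embed /= vy -surjective_pairing.
  by case: v vy => [[v|]|v] //= vy; have := ye v; rewrite /= vy eqxx.
Qed.

End Occurrences.

(** * The value is the output forest cut along the subtree *)

Section Invariant.
Variables (A B : finType) (n : nat) (D : dta A (bool * bool)).
Variables (lb : 'I_n -> dstate D -> option B) (ch : 'I_n -> 'I_n -> dstate D -> bool).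
Variable t0 : btree A.
Implicit Types (a : A) (s l r : btree A).

Local Notation context := (context n D).
Local Notation onode s := (bstruct s * 'I_n)%type.
Local Notation info := (info_of n D).
Local Notation edge := (edge ch (t0 := t0)).
Local Notation olabel := (olabel lb (t0 := t0)).
Local Notation value := (value lb ch).

Hypothesis edge_ac : acyclic edge.
Hypothesis edge_parent : forall x x' y, edge x y -> edge x' y -> x = x'.

Definition sub_edge s (e : bstruct s -> bstruct t0) : rel (onode s) :=
  fun u v => edge (embed e u) (embed e v).

Definition port_hole s (c : context) (rho : colour n D -> hforest B) (u : onode s) :
    hforest B :=
  if colour_of D u \in c.2 then rho (colour_of D u) else hzero.

Definition sub_read s (e : bstruct s -> bstruct t0) (c : context) rho : onode s ->
  hforest B :=
  read (sub_edge e) (fun u => olabel (embed e u)) (port_hole c rho).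

Definition cut_value s (e : bstruct s -> bstruct t0) (c : context) k rho : hforest B :=
  \hsum_(u | (colour_of D u == k) && [forall v, ~~ sub_edge e v u]) sub_read e c rho u.

Lemma sub_edge_ac s (e : bstruct s -> bstruct t0) : acyclic (sub_edge e).
Proof. exact: (acyclic_sub (f := embed e)) edge_ac. Qed.

Lemma port_inj s (e : bstruct s -> bstruct t0) c : occurs ch e c ->
  forall u v : onode s, colour_of D u \in c.2 -> colour_of D u = colour_of D v -> u = v.
Proof.
move=> oe u v /(occurs_port oe)[y ye uy] uv; apply: (embed_inj oe).
have vy : edge (embed e v) y by rewrite -(edge_outside oe ye uv).
exact: edge_parent uy vy.
Qed.

(** With a plain hole for every label, the holes of the piece count the leaves of [m]. By
    [holes_read_roots] they are at most as many as the ports, whose colours are distinct; so [m] has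
    at most [#|colour|] leaves. *)
Lemma cut_value_small s (e : bstruct s -> bstruct t0) c (m : nform (UCF B) (colour n
  D)) k :
  occurs ch e c -> (forall rho, sem m rho = cut_value e c k rho) ->
  clip (ucf_cops B) (#|colour n D|).*2 m = m.
Proof.
move=> oe mE; case: m mE => //= t tE; rewrite ifT //.
apply: (@leq_trans (tleaves t).*2); first by rewrite -csizeE.
rewrite leq_double -(hholes_tsem (rho := fun=> hhole)); last first.
  by move=> z; exact: hholes_hole.
rewrite tE /cut_value (big_morph _ (@hholesD B) (hholes0 B)).
apply: (@leq_trans (\sum_(u | [forall v, ~~ sub_edge e v u])
    hholes (sub_read e c (fun=> hhole) u))).
  rewrite [leqRHS](bigID (fun u => colour_of D u == k)) /=.
  by rewrite (eq_bigl _ _ (fun u => andbC _ _)) leq_addr.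
apply: leq_trans (holes_read_roots _ _ (sub_edge_ac e) _) _.
  by move=> u v w uw vw; apply: (embed_inj oe); exact: edge_parent uw vw.
rewrite (eq_bigr (fun u => (colour_of D u \in c.2) : nat)); last first.
  by move=> u _; rewrite /port_hole; case: ifP; rewrite ?hholes_hole ?hholes0.
rewrite -big_mkcond sum1_card /=.
rewrite -(card_in_imset (f := colour_of D (t := s))); first exact: max_card.
by move=> u v uc _; exact: (port_inj oe uc).
Qed.

Section Step.
Variables (a : A) (l r : btree A) (e : bstruct (BNode a l r) -> bstruct t0).
Variable c : context.
Hypothesis oe : occurs ch e c.
Local Notation c1 := (left_context ch a (info l) (info r) c).
Local Notation c2 := (right_context ch a (info l) (info r) c).
Hypothesis IHl : forall k rho, sem (value l c1 k) rho = cut_value (e \o pleft a r) c1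
  k rho.
Hypothesis IHr : forall k rho,
  sem (value r c2 k) rho = cut_value (e \o @pright A a l r) c2 k rho.

Local Notation R := (sub_edge e).
Local Notation lab := (fun u => olabel (embed e u)).
Local Notation pl := (place_of D (a := a) (l := l) (r := r)).
Local Notation blk := (fun u => block_of (pl u)).

(** A new copy is alone in its place, so it may always count as a port without spoiling
    injectivity. *)
Definition block_port (u : onode (BNode a l r)) : bool :=
  match pl u with
  | inl (inl k) => k \in c1.2
  | inl (inr k) => k \in c2.2
  | inr _ => true
  end.

Lemma oleft_inj : injective (@oleft _ n a l r).
Proof. by move=> [u i] [v j] [-> ->]. Qed.

Lemma oright_inj : injective (@oright _ n a l r).
Proof. by move=> [u i] [v j] [-> ->]. Qed.

Lemma block_left u : blk u = inl true -> u \in codom (@oleft _ n a l r).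
Proof. by case: u => -[[u|]|u] i // _; apply/codomP; exists (u, i). Qed.

Lemma block_right u : blk u = inl false -> u \in codom (@oright _ n a l r).
Proof. by case: u => -[[u|]|u] i // _; apply/codomP; exists (u, i). Qed.

(** The left subtree forms one block, so [read_embed] applies along [oleft]. *)
Lemma block_value_left k rho' :
  block_value R lab blk pl block_port (inl (inl k)) rho' =
  cut_value (e \o pleft a r) c1 k (fun k => rho' (inl (inl k))).
Proof.
have plE (u : onode l) : pl (oleft a r u) = inl (inl (colour_of D u)) by case: u.
have withinE u v : within R blk (oleft a r u) (oleft a r v) = sub_edge (e \o pleft a
  r) u v.
  by rewrite /within !plE eqxx andbT.
rewrite /block_value (hsum_inj _ oleft_inj); last first.
  move=> u /andP[/eqP uk _]; apply: block_left; by rewrite uk.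
apply: eq_big => [u|u _].
  rewrite plE; congr andb; apply/forallP/forallP => uroot v.
    by rewrite -withinE.
  apply/negP => vu; have /codomP[w vw] : v \in codom (@oleft _ n a l r).
    by apply: block_left; case/andP: vu => _ /eqP ->; rewrite plE.
  by move: vu (uroot w); rewrite vw withinE => ->.
apply: (read_embed oleft_inj) => //.
- by apply: (acyclic_sub (f := id)) (sub_edge_ac e) => x y /andP[].
- by move=> v y /andP[_ /eqP vy]; apply: block_left; rewrite -vy plE.
Qed.

Lemma block_value_right k rho' :
  block_value R lab blk pl block_port (inl (inr k)) rho' =
  cut_value (e \o @pright A a l r) c2 k (fun k => rho' (inl (inr k))).
Proof.
have plE (u : onode r) : pl (oright a l u) = inl (inr (colour_of D u)) by case: u.
have withinE u v : within R blk (oright a l u) (oright a l v) =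
    sub_edge (e \o @pright A a l r) u v.
  by rewrite /within !plE eqxx andbT.
rewrite /block_value (hsum_inj _ oright_inj); last first.
  move=> u /andP[/eqP uk _]; apply: block_right; by rewrite uk.
apply: eq_big => [u|u _].
  rewrite plE; congr andb; apply/forallP/forallP => uroot v.
    by rewrite -withinE.
  apply/negP => vu; have /codomP[w vw] : v \in codom (@oright _ n a l r).
    by apply: block_right; case/andP: vu => _ /eqP ->; rewrite plE.
  by move: vu (uroot w); rewrite vw withinE => ->.
apply: (read_embed oright_inj) => //.
- by apply: (acyclic_sub (f := id)) (sub_edge_ac e) => x y /andP[].
- by move=> v y /andP[_ /eqP vy]; apply: block_right; rewrite -vy plE.
Qed.

(** The block is a single node, and acyclicity excludes a loop on it. *)
Lemma block_value_new i rho' :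
  block_value R lab blk pl block_port (inr i) rho' =
  if lb i (c.1 (step_state a (info l) (info r) (Some (inr i)) None)) is Some b
  then hnode b (rho' (inr i)) else hzero.
Proof.
have Rirr x : R x x = false.
  by have [dep depR] := sub_edge_ac e; apply/negP => /depR; rewrite ltnn.
pose x : onode (BNode a l r) := (proot a l r, i).
have xE y : blk y = inr i -> y = x by case: y => -[[u|]|u] j // [->].
have nwithin y : within R blk x y = false.
  apply/negP => /andP[xy /eqP yb]; move: xy; rewrite (xE y) ?Rirr //.
rewrite /block_value (big_pred1 x) => [|y].
  rewrite readP; last by apply: (acyclic_sub (f := id)) (sub_edge_ac e) => u v /andP[].
  rewrite big_pred0 // hadd0 /= (olabel_embed lb oe) /=.
  by rewrite -[step_state _ _ _ _ _](step_stateE (x := Some x) (y := None)).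
apply/andP/eqP => [[/eqP yi _]|->]; first by apply: xE; rewrite yi.
split=> //; apply/forallP => z; apply/negP => /andP[zx /eqP zb].
by move: zx; rewrite (xE z) ?Rirr.
Qed.

Lemma value_stepE k rho :
  sem (value_step lb ch a (info l) (info r) c (ucf_cops B) (value l c1) (value r c2)
    k) rho =
  cut_value e c k rho.
Proof.
have ol := occurs_left oe; have or := occurs_right oe.
pose m := nmerge (ucf_cops B) (link ch a (info l) (info r) c)
  (port a (info l) (info r) c) (has_parent ch a (info l) (info r) c)
  (new_colour a (info l) (info r))
  (place_value lb a (info l) (info r) c (ucf_cops B) (value l c1) (value r c2)) k.
(* The unclipped form already has the required meaning, and this meaning bounds its size. *)
suff mE rho' : sem m rho' = cut_value e c k rho'.
  by rewrite /value_step (cut_value_small oe mE) mE.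
rewrite /m (@sem_merge _ _ _ _ _ _ _ _ (block_value R lab blk pl block_port));
  last first.
  move=> [[k'|k']|i] sigma.
  - by rewrite block_value_left -IHl; exact: sem_sub.
  - by rewrite block_value_right -IHr; exact: sem_sub.
  - rewrite block_value_new /=; case: (lb _ _) => [b|] //; exact: sem_root.
rewrite merge_blocks.
- apply: eq_big => u; first by rewrite -colour_ofE.
  move=> _; congr (read _ _ _ u); apply/funext => v.
  by rewrite port_place -colour_ofE.
- exact: sub_edge_ac.
- by move=> x x' y xy x'y; apply: (embed_inj oe); exact: edge_parent xy x'y.
- by move=> x y; rewrite (link_place oe).
(* The target of a crossing edge lies outside the child subtree of its source, so the source is a
   port by [occurs_port]. *)
- move=> x y xy; rewrite /block_port => xyb.
  case: x xy xyb => -[[u|]|u] i xy xyb //=.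
    apply/(occurs_port ol (u, i)); exists (embed e y) => // v /=.
    by rewrite (inj_eq (occurs_inj oe)); case: y xyb {xy} => -[[w|]|w] j.
  apply/(occurs_port or (u, i)); exists (embed e y) => // v /=.
  by rewrite (inj_eq (occurs_inj oe)); case: y xyb {xy} => -[[w|]|w] j.
- by move=> [[[u|]|u] i]; rewrite /block_port //= inE => ->.
- move=> [[[u|]|u] i] [[[v|]|v] j]; rewrite /block_port //= => bu _ //.
  + by case=> uv1 uv2 ij; have [-> ->] := port_inj ol (u := (u, i)) (v := (v, j)) bu
      (congr2 pair (congr2 pair uv1 uv2) ij).
  + by case=> ->.
  + by case=> uv1 uv2 ij; have [-> ->] := port_inj or (u := (u, i)) (v := (v, j)) bu
      (congr2 pair (congr2 pair uv1 uv2) ij).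
- move=> x xroot; apply/(has_parentP oe)/existsP => [[y yx _]|[y yx]]; exists y => //.
  exact: xroot.
Qed.

End Step.

Lemma value_cut s (e : bstruct s -> bstruct t0) c k rho : occurs ch e c ->
  sem (value s c k) rho = cut_value e c k rho.
Proof.
elim: s e c k rho => [|a l IHl r IHr] e c k rho oe.
  by rewrite /cut_value big1 // => -[[]].
apply: value_stepE => // k' rho'; [apply: IHl | apply: IHr].
  exact: occurs_left.
exact: occurs_right.
Qed.

(** The top context has no ports, and every root has exactly one colour, so the sum over colours is
    the sum over roots. *)
Lemma hval_result_read :
  hval (result lb ch t0) =
  \hsum_(x | [forall y, ~~ edge y x]) read edge olabel (fun=> hzero) x.
Proof.
rewrite hval_result.
under eq_bigr => k _ do rewrite (value_cut k _ (occurs_top _ _)).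
rewrite /cut_value (exchange_big_dep predT) //= [RHS]big_mkcond.
apply: eq_bigr => x _; case: ifP => xroot; last first.
  by rewrite big_pred0 // => k; rewrite -[RHS](andbF (colour_of D x == k)) -xroot;
    congr andb; apply: eq_forallb => -[].
rewrite (big_pred1 (colour_of D x)) => [|k]; last first.
  rewrite eq_sym; apply/andP/eqP => [[/eqP]//|->]; split=> //.
case: x xroot => x i _.
congr (read _ _ _ (x, i)); apply/funext => -[y j] //; last by rewrite /port_hole inE.
Qed.

End Invariant.

(** * Structures of forests *)

Section ForestStructures.
Variable A : choiceType.
Implicit Types (S T : structure A) (h g : hforest A).

(** Phrased by equations, hence invariant under isomorphism; an isomorphism of structures thus
    yields an equality of forests without rebuilding trees. *)
Definition represents S h := exists (lab : S -> A) (r : S -> hforest A),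
  [/\ forall a x, label a x = (lab x == a), acyclic (@child A S),
      forall x x' y : S, child x y -> child x' y -> x = x',
      forall x, r x = hnode (lab x) (\hsum_(y | child x y) r y)
    & \hsum_(x | [forall y, ~~ child y x]) r x = h].

Lemma represents_empty : represents (sempty A) hzero.
Proof.
exists (fun x : void => match x with end), (fun=> hzero).
by split=> [? []|||[]|] //; [exists (fun=> 0) => -[] | rewrite big1].
Qed.

Lemma hsum_sum (I J : finType) (P : pred (I + J)) (F : I + J -> hforest A) :
  \hsum_(x | P x) F x =
  hadd (\hsum_(i | P (inl i)) F (inl i)) (\hsum_(j | P (inr j)) F (inr j)).
Proof. exact: big_sumType. Qed.

Lemma represents_union S T h g :
  represents S h -> represents T g -> represents (sunion S T) (hadd h g).
Proof.
move=> [lS [rS [lSE [dS dSP] pS rSE hE]]] [lT [rT [lTE [dT dTP] pT rTE gE]]].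
exists (fun x => match x with inl x => lS x | inr x => lT x end).
exists (fun x => match x with inl x => rS x | inr x => rT x end).
split.
- by move=> a [x|x] /=.
- exists (fun x => match x with inl x => dS x | inr x => dT x end).
  by move=> [x|x] [y|y] //=; [exact: dSP | exact: dTP].
- by move=> [x|x] [x'|x'] [y|y] //=; [move=> /pS xx' /xx' -> | move=> /pT xx' /xx' ->].
- by move=> [x|x]; rewrite hsum_sum /= ?big_pred0_eq ?rSE ?rTE ?Monoid.mulm1
  ?Monoid.mul1m.
- rewrite hsum_sum -hE -gE; congr hadd; apply: eq_bigl => x.
    apply/forallP/forallP => xroot y; first exact: (xroot (inl y)).
    by case: y => y //; exact: xroot.
  apply/forallP/forallP => xroot y; first exact: (xroot (inr y)).
  by case: y => y //; exact: xroot.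
Qed.

Lemma hsum_option (I : finType) (P : pred (option I)) (F : option I -> hforest A) :
  \hsum_(x | P x) F x =
  hadd (if P None then F None else hzero) (\hsum_(i | P (Some i)) F (Some i)).
Proof.
have some_inj : injective (@Some I) by move=> x y [].
rewrite (bigID (fun x => x == None)) /=; congr hadd.
  case: ifP => PN; first by rewrite (big_pred1 None) // => -[x|] //=;
    rewrite ?PN ?andbF.
  by rewrite big_pred0 // => -[x|] /=; rewrite ?PN ?andbF.
rewrite (hsum_inj _ some_inj) => [|[x|]]; last by rewrite andbF.
  by apply: eq_bigl => x; rewrite andbT.
by move=> _; exact: codom_f.
Qed.

Lemma represents_root a S h : represents S h -> represents (sroot a S) (hnode a h).
Proof.
move=> [lS [rS [lSE [dS dSP] pS rSE hE]]].
exists (fun x => if x is Some x then lS x else a).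
exists (fun x => if x is Some x then rS x else hnode a h).
split.
- by move=> b [x|] /=; rewrite // eq_sym.
- exists (fun x => if x is Some x then (dS x).+1 else 0).
  by move=> [x|] [y|] //= /dSP.
- move=> [x|] [x'|] [y|] //=; first by move=> /pS xx' /xx' ->.
    by move=> xy /forallP/(_ x); rewrite xy.
  by move=> /forallP/(_ x') /negbTE ->.
- move=> [x|]; rewrite hsum_option /= ?hadd0 ?rSE //.
  by rewrite hE.
- rewrite hsum_option /= ifT; last by apply/forallP => -[].
  (* Only [None] is a root: a node without a parent in [S] is now its child. *)
  rewrite big1 ?Monoid.mulm1 // => x /forallP xroot; exfalso.
  have := xroot None => /= /forallPn[y /negbNE yx].
  by have := xroot (Some y); rewrite /= yx.
Qed.

Lemma represents_iso S T h : iso S T -> represents T h -> represents S h.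
Proof.
move=> [phi [phib phic phil]] [lT [rT [lTE [dT dTP] pT rTE hE]]].
have [phi' phiK phi'K] := phib; have phi_inj := can_inj phiK.
have phi_cod y : y \in codom phi by apply/codomP; exists (phi' y); rewrite phi'K.
exists (lT \o phi), (rT \o phi); split.
- by move=> a x; rewrite -phil lTE.
- by exists (dT \o phi) => x y; rewrite -phic => /dTP.
- by move=> x x' y; rewrite -!phic => xy x'y; apply: phi_inj; exact: pT xy x'y.
- move=> x /=; rewrite rTE; congr hnode; rewrite (hsum_inj _ phi_inj) //.
  by apply: eq_bigl => y; rewrite phic.
- rewrite -hE (hsum_inj _ phi_inj) //; apply: eq_bigl => x.
  apply/forallP/forallP => xroot y; last by rewrite -phic.
  by rewrite -[y]phi'K phic.
Qed.

Lemma represents_forest (s : seq (tree A)) : nholes s = 0 -> represents (fstruct s)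
  (hpi s).
Proof.
elim: s => [|t s IHs] /=; first by move=> _; exact: represents_empty.
move=> /eqP; rewrite addn_eq0 => /andP[/eqP t0 /eqP s0].
rewrite -cat1s -hadd_pi; apply: represents_union (IHs s0).
move: t t0 {s IHs s0}; apply: (@tree_nested_ind A
  (fun t => tholes t = 0 -> represents (tstruct t) (hpi [:: t]))
  (fun s => nholes s = 0 -> represents (fstruct s) (hpi s))) => //.
- by move=> a s sP /sP; rewrite -hnode_pi; exact: represents_root.
- by move=> _; exact: represents_empty.
- move=> t s tP sP /eqP; rewrite addn_eq0 => /andP[/eqP/tP t0 /eqP/sP s0].
  by rewrite -cat1s -hadd_pi; exact: represents_union.
Qed.

Lemma represents_uforest (g : uforest A) : represents (ustruct g) (val g).
Proof.
rewrite -[val g]hpi_repr; apply: represents_forest; exact: forest_ofP.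
Qed.

End ForestStructures.

(** * Transductions respect isomorphism *)

Section SatIso.
Variables (A : Type) (S T : structure A) (phi : S -> T).
Hypothesis phi_bij : bijective phi.
Hypothesis phi_child : forall x y, child (phi x) (phi y) = child x y.
Hypothesis phi_label : forall a x, label a (phi x) = label a x.

Lemma sat_iso n m (p : mso A n m) v V :
  sat p (map_tuple phi v) (map_tuple (fun X : {set S} => phi @: X) V) = sat p v V.
Proof.
have [phi' phiK phi'K] := phi_bij; have phi_inj := can_inj phiK.
elim: p v V => {n m} /= [n m a x|n m x y|n m x y|n m x X|n m p IH|n m p IHp q IHq
  |n m p IH|n m p IH] v V; rewrite ?tnth_map ?phi_child ?phi_label //.
- by rewrite inj_eq.
- by rewrite mem_imset.
- by rewrite IH.
- by rewrite IHp IHq.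
- have consE d : [tuple of phi d :: map_tuple phi v] = map_tuple phi [tuple of d :: v].
    exact: val_inj.
  apply/existsP/existsP => -[d pd]; last by exists (phi d); rewrite consE IH.
  by exists (phi' d); rewrite -IH -consE phi'K.
- pose im := fun X : {set S} => phi @: X.
  have consE X : [tuple of im X :: map_tuple im V] = map_tuple im [tuple of X :: V].
    exact: val_inj.
  apply/existsP/existsP => -[X pX]; last by exists (im X); rewrite consE IH.
  exists (phi' @: X); rewrite -IH -consE /im -imset_comp.
  by rewrite (eq_imset _ (g := id)) ?imset_id.
Qed.

Lemma sat_iso0 n (p : mso A n 0) v : sat p (map_tuple phi v) [tuple] = sat p v [tuple].
Proof. by rewrite -sat_iso; congr sat; exact: val_inj. Qed.

End SatIso.

Section TransductionIso.
Variables (A B : Type) (T : mso_transduction A B) (S S' : structure A).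
Hypothesis SS' : iso S S'.

Lemma in_dom_iso : in_dom T S = in_dom T S'.
Proof.
have [phi [phib phic phil]] := SS'.
by rewrite /in_dom -(sat_iso0 phib phic phil); congr sat; exact: val_inj.
Qed.

Lemma out_struct_iso : iso (out_struct T S) (out_struct T S').
Proof.
have [phi [phib phic phil]] := SS'; have [phi' phiK phi'K] := phib.
have presentE (x : S * 'I_(copies T)) :
    present (T := T) (phi x.1, x.2) = present (T := T) x.
  by rewrite /present -(sat_iso0 phib phic phil); congr sat; exact: val_inj.
have presentE' (x : S' * 'I_(copies T)) :
    present (T := T) (phi' x.1, x.2) = present (T := T) x.
  by rewrite -presentE /= phi'K; case: x.
pose f (x : out_struct T S) : out_struct T S' :=
  exist _ (phi (val x).1, (val x).2) (etrans (presentE _) (valP x)).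
pose f' (x : out_struct T S') : out_struct T S :=
  exist _ (phi' (val x).1, (val x).2) (etrans (presentE' _) (valP x)).
exists f; split.
- exists f' => x; apply: val_inj; rewrite /= ?phiK ?phi'K; by case: (val x).
- move=> x y /=; rewrite -(sat_iso0 phib phic phil); congr sat; exact: val_inj.
- move=> b x /=; rewrite -(sat_iso0 phib phic phil); congr sat; exact: val_inj.
Qed.

End TransductionIso.

Section OutputForest.
Variables (A : Type) (B : finType) (T : mso_transduction A B) (S : structure A).
Local Notation N := (S * 'I_(copies T))%type.

Definition out_edge (x y : N) : bool := present_child (T := T) x.1 y.1 x.2 y.2.
Definition out_label (x : N) : option B := pick_label (T := T) x.1 x.2.

(** Absent copies have neither edges nor labels: they are isolated roots that read as the empty
    forest and leave the sum unchanged. *)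
Lemma represents_out g : represents (out_struct T S) g ->
  [/\ acyclic out_edge, forall x x' y, out_edge x y -> out_edge x' y -> x = x'
    & \hsum_(x | [forall y, ~~ out_edge y x]) read out_edge out_label (fun=> hzero) x
      = g].
Proof.
move=> [lab [r [labE [dep depR] parent rE gE]]].
have edgeE (x y : out_struct T S) : out_edge (val x) (val y) = child x y.
  rewrite /out_edge /present_child -!surjective_pairing.
  by rewrite (valP x : is_true (present _)) (valP y : is_true (present _)).
have edgeP x y : out_edge x y -> present (T := T) x /\ present (T := T) y.
  by rewrite /out_edge /present_child -!surjective_pairing => /and3P[].
have edge_sub x y : out_edge x y -> exists2 uv : out_struct T S * out_struct T S,
    (x, y) = (val uv.1, val uv.2) & child uv.1 uv.2.
  move=> xy; have [px py] := edgeP _ _ xy.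
  pose u : out_struct T S := exist _ x px; pose v : out_struct T S := exist _ y py.
  by exists (u, v) => //; rewrite -[child _ _]edgeE.
have label_sub x : if insub x is Some u then out_label x = Some (lab (u : out_struct T
  S))
                   else out_label x = None.
  case: insubP => [u _ <-|px]; rewrite /out_label /pick_label -surjective_pairing;
    last first.
    by rewrite (negbTE px).
  rewrite (valP u : is_true (present _)).
  have labU b : sat (phi_label (val u).2 b) [tuple (val u).1] [tuple] = (lab u == b).
    exact: (labE b u).
  case: pickP => [b|/(_ (lab u))]; rewrite labU; first by move/eqP <-.
  by rewrite eqxx.
have ac : acyclic out_edge.
  exists (fun x => if insub x is Some u then dep (u : out_struct T S) else 0) => x y.
  by case/edge_sub=> -[u v] /= [-> ->] uv; rewrite !valK; exact: depR.
have val_codom y : present (T := T) y -> y \in codom (val : out_struct T S -> N).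
  by move=> py; apply/codomP; exists (exist _ y py).
split=> //.
  move=> x x' y /edge_sub[[u v] /= [-> ->] uv] /edge_sub[[u' v'] /= [-> vv'] u'v'].
  by congr val; apply: parent uv _; rewrite (val_inj vv').
rewrite -gE (bigID (fun x => present (T := T) x)) /= [X in hadd _ X]big1
  ?Monoid.mulm1; last first.
  move=> x /andP[_ px]; rewrite readP //; have := label_sub x.
  by rewrite insubN // => ->.
rewrite (hsum_inj (f := val : out_struct T S -> N) _ val_inj) => [|y /andP[_
  /val_codom] //].
apply: eq_big => [u|u _].
  rewrite (valP u : is_true (present _)) andbT; apply/forallP/forallP => uroot v.
    by have := uroot (val v); rewrite edgeE.
  by apply/negP => /edge_sub[[w w'] /= [_ /val_inj uw'] ww']; have := uroot w;
    rewrite uw' ww'.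
have read_val := read_embed (f := val : out_struct T S -> N) (R' := @child _
  (out_struct T S))
  (lab' := fun u => Some (lab u)) (xi := fun=> hzero) (xi' := fun=> hzero) val_inj ac
    edgeE.
rewrite (read_val out_label) //; first last.
- by move=> {}u; have := label_sub (val u); rewrite valK.
- by move=> v y /edgeP[_ /val_codom].
have ac' : acyclic (@child _ (out_struct T S)) by exists dep.
apply: (reads_unique ac' (readP _ _ ac')) => {}u.
by rewrite rE Monoid.mulm1.
Qed.

End OutputForest.

(** * Decoding and conclusion *)

Lemma dec_forest (A : finType) (rt : rtree (bin_sig A)) :
  val (dec rt) = hpi (bforest (btree_of rt)).
Proof.
elim: rt => -[a|] //= x IH.
rewrite -cat1s -hadd_pi -hnode_pi -!IH; exact: erefl.
Qed.

(** The transduction is evaluated on a representative picked by the quotient, the automaton on the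
    tree it reads; their sibling orders may differ. *)
Lemma dec_iso (A : finType) (rt : rtree (bin_sig A)) :
  iso (ustruct (dec rt)) (bstruct (btree_of rt)).
Proof.
rewrite bstructE; apply: feq_iso; apply/hforestP.
by rewrite -[LHS]/(hpi (repr (val (dec rt)))) hpi_repr dec_forest.
Qed.

Theorem proposition12 (Sigma Gamma : finType)
    (f : uforest Sigma -> option (uforest Gamma)) :
  mso_definable f ->
  exists M : reg_automaton (bin_sig Sigma) (UCF Gamma),
    forall (h : uforest Sigma) (t : rtree (bin_sig Sigma)), dec t = h ->
      outputs M t =
        (if f h is Some g then
           [set existT (UCF Gamma) false (g : UCF Gamma false)]%classic
         else set0)%classic.
Proof.
move=> [T fT]; have [D [dom [lb [ch TP]]]] := transduction_dta T.
exists (transducer dom lb ch) => h rt hE; rewrite outputs_transducer.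
set t := btree_of rt; have [domE lbE chE] := TP t.
have ht : iso (ustruct h) (bstruct t) by rewrite -hE; exact: dec_iso.
have := fT h; rewrite (in_dom_iso T ht) -domE /=; case: ifP => _; last by move=> ->.
case=> g -> gE; have th : iso (bstruct t) (ustruct h).
  have [phi [[phi' phiK phi'K] phic phil]] := ht.
  by exists phi'; split; [exists phi | move=> x y; rewrite -phic !phi'K
    | move=> a x; rewrite -phil phi'K].
(* Transports the reading of [g] along both isomorphisms, to the structure on which the automaton
   works. *)
have out_g : represents (out_struct T (bstruct t)) (val g).
  exact: represents_iso (iso_trans (out_struct_iso T th) gE) (represents_uforest g).
have edgeE : edge ch (t0 := t) = @out_edge _ _ T (bstruct t).
  by apply/funext => x; apply/funext => y; exact: chE.
have labelE : olabel lb (t0 := t) = @out_label _ _ T (bstruct t).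
  by apply/funext => x; exact: lbE.
have [ac parent sumE] := represents_out out_g.
suff -> : result lb ch t = g by [].
apply: (@hval_inj _ false); rewrite hval_result_read ?edgeE ?labelE //.
Qed.
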